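(* Let $p,q,r\ge 0$ be integers with $n=p+q+r\geq 2$, let $L=\mathrm{GL}_p\times\mathrm{GL}_q\times\mathrm{GL}_r$ (block-diagonal in $\mathrm{GL}_n$), and let $B_L\subset L$ be the Borel subgroup of upper-triangular matrices. The $L$-orbits of $\mathscr F\!\ell(1^p)\times\mathscr F\!\ell(1^q)\times\mathscr F\!\ell(1^r)\times\mathrm{Gr}(2;n)$ (diagonal action), and thus also the $B_L$-orbits of $\mathrm{Gr}(2;n)$, are parametrized by the colored diagrams of shape $(p,q,r)$. Specifically, the map $$\{\text{colored diagrams of shape }(p,q,r)\}\to\mathrm{Gr}(2;n)/B_L,\qquad \eta\mapsto B_L\cdot M_\eta$$ is a bijection, where $\mathrm{Gr}(2;n)/B_L$ denotes the set of $B_L$-orbits of $\mathrm{Gr}(2;n)$.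
   Context: $\mathbb{K}$ is an algebraically closed field of characteristic zero; $\mathrm{GL}_m=\mathrm{GL}_m(\mathbb K)$. $\mathscr F\!\ell(1^p)$ is the variety of complete flags of $\mathbb K^p$, and $\mathrm{Gr}(2;n)$ is the Grassmannian of 2-dimensional subspaces of $\mathbb K^n$. Fix a decomposition $\mathbb K^n=A\oplus B\oplus C$ with bases $(e^A_1,\dots,e^A_p)$, $(e^B_1,\dots,e^B_q)$, $(e^C_1,\dots,e^C_r)$ of $A,B,C$; $L=\mathrm{GL}(A)\times\mathrm{GL}(B)\times\mathrm{GL}(C)$ and $B_L$ is the stabilizer in $L$ of the three standard flags $(\langle e^A_1,\dots,e^A_i\rangle)_i$, $(\langle e^B_1,\dots,e^B_j\rangle)_j$, $(\langle e^C_1,\dots,e^C_k\rangle)_k$. A colored diagram of shape $(p,q,r)$ is a diagram $\eta$ with three left-justified rows of $p,q,r$ boxes respectively, some of the boxes being colored according to one of the following two rules: - either $\eta$ contains two disjoint nonempty sets $S_1,S_2$ of gray boxes, each set containing at most one box in each row (the pair $\{S_1,S_2\}$ is unordered: interchanging the two sets gives the same colored diagram); - or $\eta$ contains a single set $S$ of black boxes, containing at least one and at most two boxes in each row. Index the basis of $\mathbb K^n$ by the boxes: the $i$-th box (from the left) of the first (resp. second, third) row corresponds to $e^A_i$ (resp. $e^B_i$, $e^C_i$); write $e_x$ for the basis vector corresponding to the box $x$. Definition of $M_\eta\in\mathrm{Gr}(2;n)$. If $\eta$ has two sets $S_1,S_2$ of gray boxes, $M_\eta=\langle\sum_{x\in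 S_1}e_x,\ \sum_{x\in S_2}e_x\rangle$. If $\eta$ has a single set $S$ of black boxes, let $x,y,z$ be the left-most elements of $S$ in the three rows, named so that the numbers of elements of $S$ in the rows of $x$, $y$, $z$ are nondecreasing in this order, where, if two rows have the same number of elements of $S$, the element in the upper row is named first. When it exists, let $x'$ (resp. $y'$, $z'$) be the second element of $S$ in the row of $x$ (resp. $y$, $z$). Then: - if $\#S=3$, $S=\{x,y,z\}$: $M_\eta=\langle e_x+e_y,\ e_y+e_z\rangle$; - if $\#S=4$, $S=\{x,y,z,z'\}$: $M_\eta=\langle e_x+e_y+e_z,\ e_x-e_y+e_{z'}\rangle$; - if $\#S=5$, $S=\{x,y,y',z,z'\}$: $M_\eta=\langle e_x+e_y+e_{z'},\ e_x+e_{y'}+e_z\rangle$; - if $\#S=6$, $S=\{x,x',y,y',z,z'\}$: $M_\eta=\langle e_x+e_{y'}+e_{z'},\ e_{x'}+e_y+e_z+e_{z'}\rangle$. *)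

(* Defs.v *)
From mathcomp Require Import all_boot all_order all_algebra.
From mathcomp Require Import boolp classical_sets functions.

Set Implicit Arguments.
Unset Strict Implicit.
Unset Printing Implicit Defensive.

Import GRing.Theory.

Local Open Scope ring_scope.

Section Orbits.
Variables (G T : Type).

Definition orbit_of (H : set G) (act : G -> T -> T) (x : T) : set T :=
  [set act g x | g in H]%classic.

Definition orbits (H : set G) (act : G -> T -> T) (X : set T) : set (set T) :=
  [set orbit_of H act x | x in X]%classic.

End Orbits.

Section Diagrams.
Variables (p q r : nat).

Definition box : finType := ('I_p + 'I_q + 'I_r)%type.

Definition box_row (x : box) : 'I_3 :=
  match x with
  | inl (inl _) => @Ordinal 3 0 isT
  | inl (inr _) => @Ordinal 3 1 isT
  | inr _ => @Ordinal 3 2 isT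
  end.

Definition box_col (x : box) : nat :=
  match x with
  | inl (inl i) => i
  | inl (inr j) => j
  | inr k => k
  end.

Definition in_row (S : {set box}) (k : 'I_3) : {set box} :=
  [set x in S | box_row x == k].

(* The unordered pair {S1, S2} is encoded as a two-element set of sets. *)
Definition gray_pair (P : {set {set box}}) : bool :=
  [&& #|P| == 2, finset.set0 \notin P, finset.trivIset P
    & [forall S in P, forall k, #|in_row S k| <= 1]]%N.

Definition black_set (S : {set box}) : bool :=
  [forall k, 1 <= #|in_row S k| <= 2]%N.

Inductive colored_diagram : Type :=
  | Gray (P : {set {set box}}) of gray_pair P
  | Black (S : {set box}) of black_set S.

(* The elements of S in row k, from left to right. *)
Definition row_boxes (S : {set box}) (k : 'I_3) : seq box :=
  sort (fun x y => box_col x <= box_col y)%N (enum (in_row S k)).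

(* The rows by nondecreasing number of elements of S, upper row first in case
   of a tie. *)
Definition sorted_rows (S : {set box}) : seq 'I_3 :=
  sort (fun k l => (#|in_row S k| < #|in_row S l|) ||
                   ((#|in_row S k| == #|in_row S l|) && (k <= l)))%N
       (enum 'I_3).

End Diagrams.

Section Geometry.
Variables (K : closedFieldType) (p q r : nat).

Local Notation n := (p + q + r)%N.

Definition box_index (x : box p q r) : 'I_n :=
  match x with
  | inl (inl i) => lshift r (lshift q i)
  | inl (inr j) => lshift r (rshift p j)
  | inr k => rshift (p + q) k
  end.

Definition e_ (x : box p q r) : 'cV[K]_n := delta_mx (box_index x) 0.

Definition gray_space (P : {set {set box p q r}}) : {vspace 'cV[K]_n} :=
  (\sum_(S in P) <[(\sum_(x in S) e_ x)%R]>)%VS.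

(* x, y, z stand here for the basis vectors e_x, e_y, e_z, and likewise for
   x', y', z'; a primed vector which does not exist has the junk value 0 and is
   not used. *)
Definition black_space (S : {set box p q r}) : {vspace 'cV[K]_n} :=
  let vec (a b : nat) : 'cV[K]_n :=
    [seq e_ t | t <- row_boxes S (nth ord0 (sorted_rows S) a)]`_b in
  let x := vec 0%N 0%N in let x' := vec 0%N 1%N in
  let y := vec 1%N 0%N in let y' := vec 1%N 1%N in
  let z := vec 2%N 0%N in let z' := vec 2%N 1%N in
  match #|S| with
  | 3 => (<[x + y]> + <[y + z]>)%VS
  | 4 => (<[x + y + z]> + <[x - y + z']>)%VS
  | 5 => (<[x + y + z']> + <[x + y' + z]>)%VS
  | 6 => (<[x + y' + z']> + <[x' + y + z + z']>)%VS
  | _ => 0%VS (* not a black set *)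
  end.

Definition M_ (eta : colored_diagram p q r) : {vspace 'cV[K]_n} :=
  match eta with
  | Gray P _ => gray_space P
  | Black T _ => black_space T
  end.

Definition Gr2 (m : nat) : set {vspace 'cV[K]_m} :=
  [set V | \dim V = 2]%classic.

Arguments Gr2 : clear implicits.

(* A flag of K^m is the family of its members F 0, ..., F m. *)
Definition flag (m : nat) : Type := 'I_m.+1 -> {vspace 'cV[K]_m}.

Definition complete_flags (m : nat) : set (flag m) :=
  [set F : flag m | (forall i, \dim (F i) = i) /\
           (forall i j : 'I_m.+1, (i <= j)%N -> (F i <= F j)%VS)]%classic.

Arguments complete_flags : clear implicits.

Definition std_flag (m : nat) : flag m :=
  fun i => (\sum_(j < m | (j < i)%N) <[(delta_mx j 0)%R]>)%VS.

Arguments std_flag : clear implicits.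

Definition mx_act (m : nat) (g : 'M[K]_m) (V : {vspace 'cV[K]_m}) :
  {vspace 'cV[K]_m} := (linfun (mulmx g) @: V)%VS.

Definition flag_act (m : nat) (g : 'M[K]_m) (F : flag m) : flag m :=
  fun i => mx_act g (F i).

Definition triple : Type := ('M[K]_p * 'M[K]_q * 'M[K]_r)%type.

Definition block_diag (g : triple) : 'M[K]_n :=
  let: (a, b, c) := g in block_mx (block_mx a 0 0 b) 0 0 c.

Definition L_group : set triple :=
  [set g | [/\ g.1.1 \in unitmx, g.1.2 \in unitmx & g.2 \in unitmx]]%classic.

(* is_trig_mx means lower triangular, hence the transposes. *)
Definition B_L : set triple :=
  [set g | L_group g /\
     [/\ is_trig_mx g.1.1^T, is_trig_mx g.1.2^T & is_trig_mx g.2^T]]%classic.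

Definition act_Gr (g : triple) (V : {vspace 'cV[K]_n}) : {vspace 'cV[K]_n} :=
  mx_act (block_diag g) V.

Definition flags_Gr : Type :=
  (flag p * flag q * flag r * {vspace 'cV[K]_n})%type.

Definition flags_Gr_variety : set flags_Gr :=
  (complete_flags p `*` complete_flags q `*` complete_flags r `*` Gr2 n)%classic.

Definition act_flags_Gr (g : triple) (x : flags_Gr) : flags_Gr :=
  let: (a, b, c) := g in
  let: (F1, F2, F3, V) := x in
  (flag_act a F1, flag_act b F2, flag_act c F3, act_Gr g V).

Definition flags_M_ (eta : colored_diagram p q r) : flags_Gr :=
  (std_flag p, std_flag q, std_flag r, M_ eta).

End Geometry.

Arguments Gr2 : clear implicits.
Arguments complete_flags : clear implicits.
Arguments std_flag : clear implicits.
Arguments L_group : clear implicits.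
Arguments B_L : clear implicits.
Arguments act_Gr : clear implicits.
Arguments flags_Gr_variety : clear implicits.
Arguments act_flags_Gr : clear implicits.
Arguments M_ K {p q r} eta.
Arguments flags_M_ K {p q r} eta.

(* Main.v *)
(* Write a plane of K^n as the column span of an n x 2 matrix; its rows u_x are
   indexed by the boxes, and the matrix is defined up to GL_2 on the right.
   Upper triangular row operations preserve exactly, in each of the three row
   blocks, the filtration of K^2 by the spans of the u_y with y weakly to the
   right of a given box.  In dimension 2 such a filtration amounts to its jumps
   (at most two boxes) and, if there is a jump, to the line where it has
   dimension 1.  Hence the B_L-orbits correspond to the sets of jumps together
   with the configurations of at most three points of P^1 up to PGL_2, that is,
   with the coincidences among these points.  If at most two of the points are
   distinct, they split the jumps into two gray sets: the last jump of a row
   belongs to the set of its point and the other one to the opposite set.  Three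
   distinct points give a black diagram.  Finally L acts transitively on
   triples of complete flags, B_L being the stabilizer of the standard triple. *)

Require Import Defs.
From mathcomp Require Import all_boot all_order all_algebra.
From mathcomp Require Import ring boolp.

Set Implicit Arguments.
Unset Strict Implicit.
Unset Printing Implicit Defensive.

Import GRing.Theory.

Local Open Scope ring_scope.

(** * Adding a line to a subspace *)

Section Dimension.
Variables (K : fieldType) (vT : vectType K).
Implicit Types (U : {vspace vT}) (v : vT).

Lemma dim_add_line U v : v \notin U -> \dim (U + <[v]>) = (\dim U).+1.
Proof.
move=> vU; have v0 : v != 0 by apply: contraNneq vU => ->; rewrite mem0v.
rewrite dimv_disjoint_sum ?dim_vline ?v0 ?addn1 //.
apply/eqP; rewrite -subv0; apply/subvP => w /memv_capP[wU /vlineP[c wE]].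
have [c0|c0] := eqVneq c 0; first by rewrite memv0 wE c0 scale0r.
by case/negP: vU; rewrite -(scale1r v) -(mulVf c0) -scalerA -wE memvZ.
Qed.

End Dimension.

(** * Filtrations by tails of a family and upper triangular changes of family *)

Section Filtration.
Variables (K : fieldType) (vT : vectType K) (m : nat).
Implicit Types (u : 'I_m -> vT) (g : 'M[K]_m).

(** Tails are the relevant spans because an upper triangular matrix replaces each vector by a
    combination of itself and later ones. *)
Definition tail_span u (i : nat) : {vspace vT} :=
  (\sum_(j < m | (i <= j)%N) <[u j]>)%VS.

Lemma mem_tail_span u (i : nat) (j : 'I_m) : (i <= j)%N -> u j \in tail_span u i.
Proof. by move=> ij; apply: subvP (memv_line _); apply: sumv_sup ij _. Qed.

Lemma tail_spanS u (i : 'I_m) : tail_span u i = (<[u i]> + tail_span u i.+1)%VS.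
Proof.
rewrite /tail_span (bigD1 i) //=; congr (_ + _)%VS; apply: eq_bigl => j.
by rewrite ltn_neqAle andbC eq_sym.
Qed.

Lemma tail_span_out u i : (m <= i)%N -> tail_span u i = 0%VS.
Proof.
move=> mi; rewrite /tail_span big_pred0 // => j; apply/negbTE.
by rewrite -ltnNge (leq_trans (ltn_ord j)).
Qed.

(** The coefficients form a total function vanishing before [i], so that they can serve directly as
    a row of an upper triangular matrix. *)
Lemma tail_spanP u i (v : vT) :
  reflect (exists2 c : 'I_m -> K, (forall j : 'I_m, (j < i)%N -> c j = 0) &
             v = \sum_j c j *: u j) (v \in tail_span u i).
Proof.
apply: (iffP memv_sumP) => [[vs vsP ->]|[c c0 ->]].
  have /fin_all_exists[c cP] (j : 'I_m) : exists c : K,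
      ((j < i)%N -> c = 0) /\ ((i <= j)%N -> vs j = c *: u j).
    have [ij|ji] := leqP i j; last by exists 0.
    by have /vlineP[c ->] := vsP j ij; exists c.
  exists c => [j /(proj1 (cP j)) //|].
  rewrite [RHS](bigID (fun j : 'I_m => i <= j)%N) /= [X in _ + X]big1 ?addr0.
    by apply: eq_bigr => j /(proj2 (cP j)).
  by move=> j; rewrite -ltnNge => /(proj1 (cP j)) ->; rewrite scale0r.
exists (fun j => c j *: u j) => [j _|]; first by rewrite memvZ ?memv_line.
rewrite [LHS](bigID (fun j : 'I_m => i <= j)%N) /= [X in _ + X]big1 ?addr0 //.
by move=> j; rewrite -ltnNge => /c0 ->; rewrite scale0r.
Qed.

(* Modulo [tail_span u i.+1], either [u i] and [u' i] span the same line, or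
   both vanish and the diagonal coefficient can be chosen to be 1. *)
Lemma tail_span_eq_trig u u' :
  (forall i, tail_span u i = tail_span u' i) ->
  exists g, [/\ g \in unitmx, is_trig_mx g^T
              & forall i, u i = \sum_j g i j *: u' j].
Proof.
move=> uu'.
have /fin_all_exists[c cP] (i : 'I_m) : exists c : 'I_m -> K,
    [/\ c i != 0, forall j : 'I_m, (j < i)%N -> c j = 0 & u i = \sum_j c j *: u' j].
  have [ui|ui] := boolP (u' i \in tail_span u' i.+1).
    have : u i - u' i \in tail_span u' i.+1.
      rewrite rpredB // -uu'; move: (mem_tail_span u (leqnn i)).
      by rewrite uu' tail_spanS -uu'; move: ui; rewrite memvE => /addv_idPr; rewrite uu' => ->.
    case/tail_spanP=> c c0 cE; exists (fun j => c j + (j == i)%:R); split.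
    - by rewrite c0 // add0r eqxx oner_neq0.
    - move=> j ji; rewrite c0 ?(leqW ji) // add0r.
      by have /negPf-> : j != i by apply: contraTneq ji => ->; rewrite ltnn.
    - rewrite (eq_bigr (fun j => c j *: u' j + (j == i)%:R *: u' j)); last first.
        by move=> j _; rewrite scalerDl.
      rewrite big_split /= -cE (bigD1 i) //= eqxx scale1r big1 ?addr0 ?subrK //.
      by move=> j /negPf ->; rewrite scale0r.
  have : u i \in tail_span u' i by rewrite -uu' mem_tail_span.
  case/tail_spanP=> c c0 cE; exists c; split=> //.
  (* With a zero diagonal coefficient [u i] would already lie in the next tail span, so the common
     filtration would not drop at [i], against [ui]. *)
  apply: contraNneq ui => ci0.
  have ui : u i \in tail_span u' i.+1.
    apply/tail_spanP; exists c => // j; rewrite ltnS leq_eqVlt => /orP[|/c0 //].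
    by move/eqP/val_inj->.
  have := mem_tail_span u' (leqnn i); rewrite -uu' tail_spanS uu'.
  by move: (ui); rewrite memvE => /addv_idPr ->.
have gt : is_trig_mx (\matrix_(i, j) c i j)^T.
  by apply/is_trig_mxP => i j ij; rewrite !mxE; have [_ ->] := cP j.
exists (\matrix_(i, j) c i j); split=> // [|i].
  rewrite unitmxE -det_tr det_trig // unitfE prodf_seq_neq0.
  by apply/allP => i _; rewrite !mxE; have [] := cP i.
by have [_ _ ->] := cP i; apply: eq_bigr => j _; rewrite mxE.
Qed.

Lemma trig_unit_diag g i : g \in unitmx -> is_trig_mx g^T -> g i i != 0.
Proof.
rewrite unitmxE -det_tr => + gt; rewrite det_trig // unitfE prodf_seq_neq0.
by move=> /allP/(_ i (mem_index_enum i)); rewrite mxE.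
Qed.

(** Modulo the next tail span, [u i] is the multiple of [u' i] by a diagonal entry, which is
    nonzero; so equality passes from [i.+1] to [i]. *)
Lemma trig_tail_span_eq u u' g :
  g \in unitmx -> is_trig_mx g^T -> (forall i, u i = \sum_j g i j *: u' j) ->
  forall i, tail_span u i = tail_span u' i.
Proof.
(* The induction on [k] is a descending induction on [i], starting beyond [m], where both spans
   vanish. *)
move=> gu gt uE i; have [k le_mk] : exists k, (m <= i + k)%N by exists m; rewrite leq_addl.
elim: k i le_mk => [|k IH] i; first by rewrite addn0 => mi; rewrite !tail_span_out.
rewrite addnS -addSn => /IH {}IH; have [mi|im] := leqP m i.
  by rewrite !tail_span_out.
pose o := Ordinal im; rewrite -[i]/(val o) !tail_spanS IH /=.
have /tail_spanP h : exists2 c : 'I_m -> K, (forall j : 'I_m, (j < i.+1)%N -> c j = 0) &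
    u o - g o o *: u' o = \sum_j c j *: u' j.
  exists (fun j => if j == o then 0 else g o j) => [j|].
    rewrite ltnS leq_eqVlt -val_eqE /=; have [//|_ /= ji] := eqVneq (j : nat) i.
    by have /is_trig_mxP/(_ j o ji) := gt; rewrite mxE.
  rewrite uE (bigD1 o) //= addrAC subrr add0r [RHS](bigD1 o) //= eqxx scale0r add0r.
  by apply: eq_bigr => j /negPf ->.
have g0 := trig_unit_diag o gu gt.
apply/eqP; rewrite eqEsubv !subv_add !addvSr !andbT -!memvE; apply/andP; split.
  rewrite -[u o](subrK (g o o *: u' o)) addrC memv_add ?memvZ ?memv_line //.
have -> : u' o = (g o o)^-1 *: (u o - (u o - g o o *: u' o)).
  by rewrite opprB addrC subrK scalerA mulVf // scale1r.
by rewrite memvZ // memv_add ?memv_line ?rpredN.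
Qed.

End Filtration.

(** * Determinants in the plane and configurations of points of the projective line *)

Section Plane.
Variable K : fieldType.
Implicit Types a b c : 'rV[K]_2.

Definition det2 a b : K := a 0 0 * b 0 1 - a 0 1 * b 0 0.

Lemma rV2P a b : a 0 0 = b 0 0 -> a 0 1 = b 0 1 -> a = b.
Proof.
by move=> ab0 ab1; apply/rowP => i; case: (splitP (i : 'I_(1 + 1))) => j ij;
  [have -> : i = 0 by apply/val_inj; rewrite /= ij; case: j {ij} => [[]]
  |have -> : i = 1 by apply/val_inj; rewrite /= ij; case: j {ij} => [[]]].
Qed.

Lemma det2aa a : det2 a a = 0.
Proof. by rewrite /det2 mulrC subrr. Qed.

Lemma det2C a b : det2 a b = - det2 b a.
Proof. by rewrite /det2; ring. Qed.

Lemma det2C_eq0 a b : (det2 a b == 0) = (det2 b a == 0).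
Proof. by rewrite det2C oppr_eq0. Qed.

Lemma det20 a : det2 a 0 = 0.
Proof. by rewrite /det2 !mxE; ring. Qed.

Lemma det2Zl x a b : det2 (x *: a) b = x * det2 a b.
Proof. by rewrite /det2 !mxE; ring. Qed.

Lemma det2Zr x a b : det2 a (x *: b) = x * det2 a b.
Proof. by rewrite /det2 !mxE; ring. Qed.

Lemma det2_neq0 a b : det2 a b != 0 -> a != 0 /\ b != 0.
Proof.
by move=> ab; split; apply: contraNneq ab => ->; rewrite ?det20 // det2C det20 oppr0.
Qed.

(** Cramer's rule with the denominator cleared. *)
Lemma det2_expand a b c : det2 a b *: c = det2 c b *: a + det2 a c *: b.
Proof. by apply: rV2P; rewrite !mxE /det2; ring. Qed.

Lemma det2_compl a : a != 0 -> exists b, det2 a b != 0.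
Proof.
move=> a0; have [a00|a00] := eqVneq (a 0 0) 0.
  exists (delta_mx 0 0); rewrite /det2 !mxE /= mulr0 sub0r mulr1 oppr_eq0.
  by apply: contraNneq a0 => a01; apply/eqP/rV2P; rewrite mxE.
by exists (delta_mx 0 1); rewrite /det2 !mxE /= mulr0 subr0 mulr1.
Qed.

(** Collinearity is transitive only through a nonzero middle vector, the zero vector being collinear
    with everything. *)
Lemma det2_trans a b c : b != 0 -> det2 a b = 0 -> det2 b c = 0 -> det2 a c = 0.
Proof.
move=> /det2_compl[d bd] ab bc; apply/eqP; rewrite -(mulrI_eq0 _ (mulfI bd)).
(* The three-term Plücker relation; [d] is an auxiliary vector independent of [b], so that
   [det2 b d] can be cancelled. *)
have -> : det2 b d * det2 a c = det2 a b * det2 c d + det2 a d * det2 b c.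
  by rewrite /det2; ring.
by rewrite ab bc mul0r mulr0 addr0.
Qed.

Lemma det2_eq0_line a b : b != 0 -> (det2 a b == 0) = (a \in <[b]>%VS).
Proof.
move=> b0; apply/eqP/vlineP => [ab|[x ->]]; last by rewrite det2Zl det2aa mulr0.
have [d bd] := det2_compl b0; exists ((det2 b d)^-1 * det2 a d).
by rewrite -scalerA -[_ *: b]addr0 -(scale0r d) -[X in X *: d]oppr0 -ab -det2C
  -det2_expand scalerA mulVf // scale1r.
Qed.

Lemma vline_scale (vT : vectType K) x (v : vT) : x != 0 -> <[x *: v]>%VS = <[v]>%VS.
Proof.
move=> x0; apply/eqP; rewrite eqEsubv -!memvE memvZ ?memv_line //=.
by rewrite -[v in v \in _]scale1r -(mulVf x0) -scalerA memvZ ?memv_line.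
Qed.

Lemma vline_det2_eq0 a a' b b' :
  <[a]>%VS = <[a']>%VS -> <[b]>%VS = <[b']>%VS -> (det2 a b == 0) = (det2 a' b' == 0).
Proof.
suff det2_0 c c' d d' : <[c]>%VS = <[c']>%VS -> <[d]>%VS = <[d']>%VS ->
    det2 c d == 0 -> det2 c' d' == 0 by move=> aa bb; apply/idP/idP; apply: det2_0.
move=> cc dd; have /vlineP[x ->] : c' \in <[c]>%VS by rewrite cc memv_line.
have /vlineP[y ->] : d' \in <[d]>%VS by rewrite dd memv_line.
by rewrite det2Zl det2Zr => /eqP->; rewrite !mulr0.
Qed.

Lemma det_det2 (h : 'M[K]_2) : \det h = det2 (row 0 h) (row 1 h).
Proof.
rewrite (expand_det_row _ 0) big_ord_recl big_ord1 /cofactor !det_mx11 !mxE /det2 !mxE.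
rewrite /= expr0 mul1r expr1 mulN1r mulrN.
by congr (h _ _ * h _ _ - h _ _ * h _ _); apply: val_inj.
Qed.

Lemma det2_mulmx a b (h : 'M[K]_2) : det2 (a *m h) (b *m h) = det2 a b * \det h.
Proof.
rewrite det_det2 /det2 !mxE !big_ord_recl !big_ord0 !addr0.
have -> : lift ord0 ord0 = 1 :> 'I_2 by apply: val_inj.
have -> : ord0 = 0 :> 'I_2 by apply: val_inj.
by ring.
Qed.

(** Both bases are compared with the standard one: if [h] and [h'] have them as rows,
    [invmx h *m h'] carries the first to the second. *)
Lemma det2_transport a b a' b' : det2 a b != 0 -> det2 a' b' != 0 ->
  exists2 h, h \in unitmx & a *m h = a' /\ b *m h = b'.
Proof.
have frame c d : det2 c d != 0 -> exists2 h, h \in unitmx &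
    c = delta_mx 0 0 *m h /\ d = delta_mx 0 1 *m h.
  move=> cd; pose h : 'M[K]_2 := \matrix_(i, j) (if i == 0 then c 0 j else d 0 j).
  have rc : row 0 h = c by apply/rowP => j; rewrite !mxE.
  have rd : row 1 h = d by apply/rowP => j; rewrite !mxE.
  by exists h; rewrite ?unitmxE ?det_det2 ?unitfE -?rowE rc rd.
move=> /frame[h hu [-> ->]] /frame[h' h'u [-> ->]].
by exists (invmx h *m h'); rewrite ?unitmx_mul ?unitmx_inv ?hu // -!mulmxA !mulKVmx.
Qed.

Lemma ord3_third (i j : 'I_3) : i != j ->
  exists k, [/\ k != i, k != j & forall l, [|| l == i, l == j | l == k]].
Proof.
have H : [forall i : 'I_3, forall j : 'I_3, (i != j) ==> [exists k : 'I_3,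
   [&& k != i, k != j & [forall l, [|| l == i, l == j | l == k]]]]].
  apply/forallP => -[[|[|[|//]]] ?]; apply/forallP => -[[|[|[|//]]] ?] //=;
  (* The third index for the pairs (0,1), (0,2), (1,0), (1,2), (2,0), (2,1), in this order. *)
  apply/existsP; [exists (inord 2)|exists (inord 1)|exists (inord 2)
    |exists (inord 0)|exists (inord 1)|exists (inord 0)];
  rewrite -!val_eqE /= !inordK //=; apply/forallP => -[[|[|[|//]]] ?] //;
  by rewrite -!val_eqE /= inordK.
move: H => /forallP/(_ i)/forallP/(_ j)/implyP H /H/existsP[k /and3P[ki kj /forallP kl]].
by exists k.
Qed.

(* Three points of a projective line are determined up to [PGL_2] by which of
   them coincide; zero vectors stand for absent points. *)
Lemma three_lines_transport (a a' : 'I_3 -> 'rV[K]_2) :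
  (forall k, (a k == 0) = (a' k == 0)) ->
  (forall k l, (det2 (a k) (a l) == 0) = (det2 (a' k) (a' l) == 0)) ->
  exists2 h, h \in unitmx & forall k, <[a k *m h]>%VS = <[a' k]>%VS.
Proof.
move=> a0 aD.
have [/existsP[i /existsP[j ij]]|/existsPn allD] :=
    boolP [exists i, exists j, det2 (a i) (a j) != 0]; last first.
  have {}allD k l : det2 (a k) (a l) = 0.
    by move: (allD k) => /existsPn/(_ l); rewrite negbK => /eqP.
  have [/existsP[i ai]|/existsPn allz] := boolP [exists i, a i != 0]; last first.
    exists 1%:M => [|k]; rewrite ?unitmx1 // mulmx1.
    by move: (allz k) (a0 k) => /negPn/eqP->; rewrite eqxx => /esym/eqP->.
  have a'i : a' i != 0 by rewrite -a0.
  have [b ab] := det2_compl ai; have [b' ab'] := det2_compl a'i.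
  have [h hu [aih _]] := det2_transport ab ab'; exists h => // k.
  have /vlineP[x akE] : a k \in <[a i]>%VS by rewrite -det2_eq0_line ?allD.
  have /vlineP[x' a'kE] : a' k \in <[a' i]>%VS by rewrite -det2_eq0_line // -aD allD.
  have := a0 k; rewrite akE a'kE -scalemxAl aih !scaler_eq0 (negPf ai) (negPf a'i) !orbF.
  have [->|x0] := eqVneq x 0; first by move=> /esym/eqP->; rewrite !scale0r.
  by move=> /esym/negbT x'0; rewrite !vline_scale.
have ij' : det2 (a' i) (a' j) != 0 by rewrite -aD.
have neq_ij : i != j by apply: contraNneq ij => ->; rewrite det2aa.
have [k [_ _ kl]] := ord3_third neq_ij.
(* Two of the points are distinct and give a basis; the third vector is expanded in it, on both
   sides. *)
have coord (c : 'I_3 -> 'rV[K]_2) : det2 (c i) (c j) != 0 ->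
    c k = (det2 (c k) (c j) / det2 (c i) (c j)) *: c i +
          (det2 (c i) (c k) / det2 (c i) (c j)) *: c j.
  move=> d0; rewrite 2!(mulrC _ (_ ^-1)) -!scalerA -scalerDr -det2_expand.
  by rewrite scalerA mulVf // scale1r.
(* Corresponding coordinates vanish together, so they agree after rescaling by nonzero [s] and [t].
   Sending the basis to [s *: a' i] and [t *: a' j] keeps the target lines and sends [a k] exactly
   to [a' k]. *)
have ratio (x x' : K) : (x == 0) = (x' == 0) -> exists2 s, s != 0 & x * s = x'.
  have [->|x0] := eqVneq x 0; first by move=> /esym/eqP->; exists 1; rewrite ?oner_eq0 ?mul0r.
  move=> /esym/negbT x'0; exists (x' / x); first by rewrite mulf_neq0 ?invr_eq0.
  by rewrite mulrC divfK.
set d := det2 (a i) (a j) in ij coord; set d' := det2 (a' i) (a' j) in ij'.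
have [|s s0 sE] := ratio (det2 (a k) (a j) / d) (det2 (a' k) (a' j) / d').
  by rewrite !mulf_eq0 !invr_eq0 (negPf ij) (negPf ij') !orbF aD.
have [|t t0 tE] := ratio (det2 (a i) (a k) / d) (det2 (a' i) (a' k) / d').
  by rewrite !mulf_eq0 !invr_eq0 (negPf ij) (negPf ij') !orbF aD.
have st : det2 (s *: a' i) (t *: a' j) != 0 by rewrite det2Zl det2Zr !mulf_neq0.
have [h hu [ai aj]] := det2_transport ij st; exists h => // l.
case/or3P: (kl l) => /eqP->; first by rewrite ai vline_scale.
  by rewrite aj vline_scale.
by rewrite (coord a) // mulmxDl -!scalemxAl ai aj !scalerA sE tE -(coord a').
Qed.

End Plane.

(** * The filtrations attached to the three rows of boxes, their jumps and their lines *)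

Section RowSpans.
Variables (K : fieldType) (p q r : nat).
Local Notation box := (box p q r).
Implicit Types (u : box -> 'rV[K]_2) (x y : box) (S : {set box}) (k : 'I_3).

Lemma box_inj x y : box_row x = box_row y -> box_col x = box_col y -> x = y.
Proof. by case: x y => [[i|i]|i] [[j|j]|j] //= _ /val_inj->. Qed.

(** A crude bound common to the three rows, from which descending inductions on the column can
    start. *)
Lemma ltn_box_col x : (box_col x < p + q + r)%N.
Proof.
case: x => [[[i ip]|[i ip]]|[i ip]] /=; apply: (leq_trans ip).
- by rewrite -addnA leq_addr.
- by rewrite addnAC leq_addl.
- by rewrite leq_addl.
Qed.

(** This is [tail_span] for row [k], indexed by all boxes so that the three rows are treated at
    once. *)
Definition row_span u k (i : nat) : {vspace 'rV[K]_2} :=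
  (\sum_(x | (box_row x == k) && (i <= box_col x)%N) <[u x]>)%VS.

Definition jumps u : {set box} :=
  [set x | u x \notin row_span u (box_row x) (box_col x).+1].

(** The top box of a row is its right-most one: there the filtration, read from the right, first
    becomes nonzero, so for a jump set its vector spans the line of the row. *)
Definition is_top S x : bool :=
  (x \in S) && [forall y in S, (box_row y == box_row x) ==> (box_col y <= box_col x)%N].

(* 0 if [S] has no box in row [k] *)
Definition top_vec u S k : 'rV[K]_2 :=
  if [pick x | is_top S x && (box_row x == k)] is Some x then u x else 0.

Lemma row_spanS u x :
  row_span u (box_row x) (box_col x) =
  (<[u x]> + row_span u (box_row x) (box_col x).+1)%VS.
Proof.
rewrite /row_span (bigD1 x) /= ?eqxx ?leqnn //; congr (_ + _)%VS.
apply: eq_bigl => y; rewrite -andbA; have [yx|] //= := eqVneq (box_row y).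
rewrite ltn_neqAle andbC [in RHS]eq_sym; congr (~~ _ && _).
by apply/eqP/eqP => [->|/(box_inj yx)].
Qed.

Lemma row_span_skip u k i : (forall x, box_row x = k -> box_col x <> i) ->
  row_span u k i = row_span u k i.+1.
Proof.
move=> ki; apply: eq_bigl => x; have [xk|] //= := eqVneq (box_row x).
by rewrite leq_eqVlt; case: eqP => // /esym/(ki x xk).
Qed.

Lemma row_span_out u k i : (p + q + r <= i)%N -> row_span u k i = 0%VS.
Proof.
move=> ni; rewrite /row_span big_pred0 // => x; apply/negbTE.
by rewrite negb_and -ltnNge orbC (leq_trans (ltn_box_col x) ni).
Qed.

Lemma mem_row_span u x : u x \in row_span u (box_row x) (box_col x).
Proof. by rewrite row_spanS memvE addvSl. Qed.

Lemma in_jumps u x : (x \in jumps u) =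
  (row_span u (box_row x) (box_col x) != row_span u (box_row x) (box_col x).+1).
Proof.
by rewrite inE row_spanS memvE; congr (~~ _); apply/addv_idPr/eqP.
Qed.

(** Read from the right, the filtration grows by exactly one dimension at each jump and is constant
    elsewhere. *)
Lemma dim_row_span u k i :
  \dim (row_span u k i) = #|[set x in jumps u | (box_row x == k) && (i <= box_col x)%N]|.
Proof.
have [m le_m] : exists m, (p + q + r <= i + m)%N by exists (p + q + r); rewrite leq_addl.
elim: m i le_m => [|m IH] i.
  rewrite addn0 => ni; rewrite row_span_out // dimv0; apply/esym/eqP.
  rewrite cards_eq0; apply/eqP/setP => x; rewrite !inE; apply/negbTE.
  by rewrite !negb_and -ltnNge (leq_trans (ltn_box_col x) ni) !orbT.
rewrite addnS -addSn => /IH {}IH.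
(* Column [i] may lie beyond the end of row [k], or hold a box that is not a jump, or hold a jump;
   only the last case changes the dimension. *)
case: (pickP (fun x : box => (box_row x == k) && (box_col x == i))) => [x|nox]; last first.
  rewrite row_span_skip ?IH => [|x xk xi].
    apply: eq_card => x; rewrite !inE; move: (nox x) => /=.
    by rewrite (leq_eqVlt i) (eq_sym i); case: (box_row x == k) => //= ->.
  by move: (nox x); rewrite /= xk xi !eqxx.
case/andP=> /eqP xk /eqP xi; subst k i.
have [xJ|xJ] := boolP (x \in jumps u); last first.
  move: (xJ); rewrite in_jumps negbK => /eqP->; rewrite IH.
  apply: eq_card => y; rewrite 2!in_set; have [yx|] := eqVneq (box_row y); rewrite ?andbF //=.
  rewrite (leq_eqVlt (box_col x)); have [xy|] //= := eqVneq (box_col x) (box_col y).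
  by have <- : x = y; [apply: box_inj|rewrite (negPf xJ)].
rewrite row_spanS addvC dim_add_line ?IH; last by move: xJ; rewrite inE.
have -> : [set y in jumps u | (box_row y == box_row x) && (box_col x <= box_col y)%N] =
    x |: [set y in jumps u | (box_row y == box_row x) && (box_col x < box_col y)%N].
  apply/setP => y; rewrite in_setU1 2!in_set.
  have [->|neq_yx] /= := eqVneq y x; first by rewrite xJ eqxx leqnn.
  congr (_ && _); have [yx|] //= := eqVneq (box_row y).
  rewrite leq_eqVlt; case: eqP => // xy.
  by case/eqP: neq_yx; apply: box_inj.
by rewrite cardsU1 in_set ltnn !andbF.
Qed.

Lemma mem_in_row S k x : (x \in in_row S k) = (x \in S) && (box_row x == k).
Proof. by rewrite inE. Qed.

Lemma card_in_row_jumps u k : #|in_row (jumps u) k| = \dim (row_span u k 0).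
Proof. by rewrite dim_row_span; apply: eq_card => x; rewrite !inE andbT. Qed.

Lemma card_in_row_jumps_le2 u k : (#|in_row (jumps u) k| <= 2)%N.
Proof.
by rewrite card_in_row_jumps (leq_trans (dimvS (subvf _))) // dimvf /dim /= mul1n.
Qed.

Lemma is_top_uniq S x y : is_top S x -> is_top S y -> box_row x = box_row y -> x = y.
Proof.
case/andP=> xS /'forall_implyP xT /andP[yS /'forall_implyP yT] xy; apply: box_inj => //.
apply/eqP; rewrite eqn_leq.
by have /implyP-> := yT x xS; rewrite ?xy //; have /implyP-> := xT y yS; rewrite ?xy.
Qed.

Lemma is_top_mem S x : is_top S x -> x \in S.
Proof. by case/andP. Qed.

Lemma is_top_exists S x : x \in S -> exists2 y, is_top S y & box_row y = box_row x.
Proof.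
move=> xS; pose P y := (y \in S) && (box_row y == box_row x).
have Px : P x by rewrite /P xS eqxx.
case: (arg_maxnP (fun y => box_col y) Px) => y /andP[yS /eqP yx] ymax.
exists y => //; rewrite /is_top yS; apply/'forall_implyP => z zS; apply/implyP.
by rewrite yx => zx; apply: ymax; rewrite /P zS.
Qed.

Lemma top_vecE u S x : is_top S x -> top_vec u S (box_row x) = u x.
Proof.
move=> xT; rewrite /top_vec; case: pickP => [y /andP[yT /eqP]|/(_ x)].
  by move/(is_top_uniq yT xT) ->.
by rewrite xT eqxx.
Qed.

Lemma top_vec_out u S k : in_row S k = set0 -> top_vec u S k = 0.
Proof.
move=> Sk; rewrite /top_vec; case: pickP => // x /andP[/is_top_mem xS xk].
by move/setP/(_ x): Sk; rewrite !inE xS xk.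
Qed.

Lemma row_span_top u x : is_top (jumps u) x ->
  u x != 0 /\ row_span u (box_row x) (box_col x) = <[u x]>%VS.
Proof.
case/andP=> xJ /'forall_implyP xT.
have u0 : u x != 0 by move: xJ; rewrite inE; apply: contraNneq => ->; rewrite mem0v.
split=> //; apply/esym/eqP; rewrite eqEdim -memvE mem_row_span dim_vline u0 dim_row_span.
apply: (@leq_trans #|[set x]|); last by rewrite cards1.
apply/subset_leq_card/subsetP => y; rewrite in_set in_set1.
case/and3P=> yJ /eqP yx lexy; apply/eqP/box_inj => //; apply/eqP.
by rewrite eqn_leq lexy (implyP (xT y yJ)) ?yx.
Qed.

Lemma top_vec_jumps_eq0 u k : (top_vec u (jumps u) k == 0) = (in_row (jumps u) k == set0).
Proof.
apply/idP/idP => [|/eqP/top_vec_out->//]; apply: contraTT => /set0Pn[x].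
rewrite inE => /andP[/is_top_exists[y yT yx] /eqP <-].
by rewrite -yx top_vecE //; have [] := row_span_top yT.
Qed.

(** Dimension one means a single jump from column [i] on, and this jump is then the top one of its
    row. *)
Lemma row_span_dim1 u k i : \dim (row_span u k i) = 1%N ->
  row_span u k i = <[top_vec u (jumps u) k]>%VS.
Proof.
move=> d1; move: (d1); rewrite dim_row_span => /eqP/cards1P[x xE].
have: x \in [set x] by rewrite inE.
rewrite -xE in_set => /and3P[xJ /eqP xk ix]; have [y yT yx] := is_top_exists xJ.
have [u0 sE] := row_span_top yT; apply/esym/eqP.
rewrite -xk -yx top_vecE // yx xk eqEdim d1 dim_vline u0 andbT -memvE.
have: y \in [set x].
  rewrite -xE in_set is_top_mem // yx xk eqxx (leq_trans ix) //.
  by case/andP: yT => _ /'forall_implyP/(_ x xJ)/implyP->; rewrite ?yx.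
rewrite inE => /eqP ->; apply: subvP (mem_row_span u x).
apply/subv_sumP => z /andP[/eqP zx xz].
by apply: sumv_sup (subvv _); rewrite zx xk eqxx (leq_trans ix).
Qed.

(** The jumps give all dimensions. In a plane, a subspace of dimension 0 or 2 is determined by its
    dimension, and one of dimension 1 is the line of the top box. *)
Lemma row_span_eqP u u' :
  (forall k i, row_span u k i = row_span u' k i) <->
  jumps u = jumps u' /\
  forall k, <[top_vec u (jumps u) k]>%VS = <[top_vec u' (jumps u') k]>%VS.
Proof.
split=> [uu'|[JJ top_eq] k i].
  have JJ : jumps u = jumps u' by apply/setP => x; rewrite !in_jumps !uu'.
  split=> // k; have [Jk|] := eqVneq (in_row (jumps u) k) set0.
    by rewrite !top_vec_out // -JJ.
  case/set0Pn=> x; rewrite inE => /andP[/is_top_exists[y yT <-] /eqP <-].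
  rewrite -JJ !top_vecE //; have [_ <-] := row_span_top yT.
  by rewrite uu'; move: yT; rewrite JJ => /row_span_top[].
have dd : \dim (row_span u k i) = \dim (row_span u' k i) by rewrite !dim_row_span JJ.
have : (\dim (row_span u k i) <= 2)%N.
  by rewrite (leq_trans (dimvS (subvf _))) // dimvf /dim /= mul1n.
have full (U : {vspace 'rV[K]_2}) : \dim U = 2%N -> U = fullv.
  by move=> dU; apply/eqP; rewrite eqEdim subvf dimvf /dim /= mul1n dU.
have [m dm] : exists m, \dim (row_span u k i) = m by exists (\dim (row_span u k i)).
case: m dm => [|[|[|m]]] E; rewrite E // => _.
- by move/eqP: (E); rewrite dimv_eq0 => /eqP->; move/eqP: E; rewrite dd dimv_eq0 => /eqP->.
- by rewrite (row_span_dim1 E) (top_eq k) [RHS]row_span_dim1 // -dd.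
- by rewrite (full _ E); apply/esym/full; rewrite -dd.
Qed.

Lemma row_span_mulmx u (h : 'M[K]_2) k i :
  row_span (fun x => u x *m h) k i = (linfun (mulmxr h) @: row_span u k i)%VS.
Proof. by rewrite limg_sum; apply: eq_bigr => x _; rewrite limg_line lfunE. Qed.

Lemma jumps_mulmx u (h : 'M[K]_2) : h \in unitmx -> jumps (fun x => u x *m h) = jumps u.
Proof.
move=> hu; apply/setP => x; rewrite !in_jumps !row_span_mulmx eq_limg_ker0 //.
by apply/lker0P => a b; rewrite !lfunE /= => /(can_inj (mulmxK hu)).
Qed.

Lemma top_vec_mulmx u S k (h : 'M[K]_2) :
  top_vec (fun x => u x *m h) S k = top_vec u S k *m h.
Proof. by rewrite /top_vec; case: pickP => // _; rewrite mul0mx. Qed.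

(** To the right of a box of [S] there is at most one other box of [S] in its row; the vectors there
    span zero or the line of that box, and the hypotheses keep [u x] out of both. *)
Lemma jumps_normal_form u S :
    (forall x, x \notin S -> u x = 0) -> (forall k, #|in_row S k| <= 2)%N ->
    (forall x, x \in S -> u x != 0) ->
    (forall x y, x \in S -> y \in S -> x != y -> box_row x = box_row y ->
       det2 (u x) (u y) != 0) ->
  jumps u = S.
Proof.
move=> u0 S2 un0 uD; apply/setP => x; rewrite inE.
have [xS|xS] := boolP (x \in S); last by rewrite u0 // mem0v.
case: (pickP (fun y => [&& y \in S, box_row y == box_row x & box_col x < box_col y]%N))
    => [y /and3P[yS /eqP yx xy]|none].
  have nxy : x != y by apply: contraTneq xy => ->; rewrite ltnn.
  apply: contra (uD x y xS yS nxy (esym yx)) => xU; rewrite det2_eq0_line ?un0 //.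
  apply: subvP xU; apply/subv_sumP => z /andP[/eqP zx xz].
  have [zS|zS] := boolP (z \in S); last by rewrite u0 // -memvE mem0v.
  have [->//|nzy] := eqVneq z y; have := S2 (box_row x); rewrite leqNgt => /negP[].
  have: [set x; y; z] \subset in_row S (box_row x).
    by apply/subsetP => w; rewrite !inE => /orP[/orP[]|] /eqP->; rewrite ?xS ?yS ?zS ?yx ?zx eqxx.
  move/subset_leq_card; apply: leq_trans.
  have nxz : x != z by apply: contraTneq xz => ->; rewrite ltnn.
  by rewrite setUC cardsU1 cards2 nxy !inE negb_or eq_sym nxz nzy.
apply: contra (un0 x xS) => xU; rewrite -memv0; apply: subvP xU.
apply/subv_sumP => y yP; have [yS|yS] := boolP (y \in S).
  by move: (none y); rewrite /= yS yP.
by rewrite u0 // -memvE mem0v.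
Qed.

End RowSpans.

(** * Planes as column spans of matrices with two columns *)

Section ColumnSpans.
Variables (K : closedFieldType) (m : nat).
Implicit Types (U : 'M[K]_(m, 2)) (v : 'cV[K]_m).

Definition col_span U : {vspace 'cV[K]_m} := limg (linfun (mulmx U : 'cV_2 -> 'cV_m)).

Definition col_pair v1 v2 : 'M[K]_(m, 2) :=
  \matrix_(i, j) (if j == 0 then v1 i 0 else v2 i 0).

Lemma col_pair_mul v1 v2 (w : 'cV[K]_2) :
  col_pair v1 v2 *m w = w 0 0 *: v1 + w 1 0 *: v2.
Proof.
apply/colP => i; rewrite !mxE !big_ord_recl big_ord0 addr0 !mxE /=.
have -> : lift ord0 ord0 = 1 :> 'I_2 by apply: val_inj.
by congr (_ + _); apply: mulrC.
Qed.

Lemma col_span_pair v1 v2 : col_span (col_pair v1 v2) = (<[v1]> + <[v2]>)%VS.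
Proof.
apply/vspaceP => v; apply/memv_imgP/memv_addP => [[w _ ->]|].
  rewrite lfunE /= col_pair_mul; exists (w 0 0 *: v1); first by rewrite memvZ ?memv_line.
  by exists (w 1 0 *: v2); rewrite // memvZ ?memv_line.
case=> _ /vlineP[a ->] [_ /vlineP[b ->] ->].
exists (\col_i (if i == 0 then a else b)); first exact: memvf.
by rewrite lfunE /= col_pair_mul !mxE.
Qed.

Lemma dim2_col_pair (V : {vspace 'cV[K]_m}) : \dim V = 2%N ->
  exists v1 v2, V = col_span (col_pair v1 v2).
Proof.
move=> dV; have := vbasisP V; move: (vbasis V); rewrite dV => b bV.
exists b`_0, b`_1; rewrite col_span_pair -(span_basis bV).
by case/tupleP: b bV => b0 b; case/tupleP: b => b1 b _; rewrite (tuple0 b) /= span_cons span_seq1.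
Qed.

(** Rank-nullity for a map from a plane. *)
Lemma lker_col_span U : \dim (col_span U) = 2%N <-> lker (linfun (mulmx U : 'cV_2 -> 'cV_m)) = 0%VS.
Proof.
have dE := limg_ker_dim (linfun (mulmx U : 'cV_2 -> 'cV_m)) fullv.
rewrite capfv dimvf /dim /= ?mul1n ?muln1 -/(col_span U) in dE; split=> [d2|k0].
  by apply/eqP; rewrite -dimv_eq0; move: dE; rewrite d2 -[RHS]add0n => /addIn->.
by move: dE; rewrite k0 dimv0 add0n.
Qed.

Lemma mx_act_col_span (g : 'M[K]_m) U : mx_act g (col_span U) = col_span (g *m U).
Proof.
rewrite /mx_act /col_span -limg_comp; congr (limg _); apply/lfunP => w.
by rewrite comp_lfunE !lfunE /= mulmxA.
Qed.

Lemma col_span_mulmx U (h : 'M[K]_2) : h \in unitmx -> col_span (U *m h) = col_span U.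
Proof.
move=> hu; apply/vspaceP => v; apply/memv_imgP/memv_imgP => -[w _ ->]; rewrite lfunE /=.
  by exists (h *m w); rewrite ?memvf // lfunE /= mulmxA.
by exists (invmx h *m w); rewrite ?memvf // lfunE /= -!mulmxA mulKVmx.
Qed.

(** The columns of [U], written in terms of those of [U'], are the columns of [h]. *)
Lemma col_span_eq U U' : \dim (col_span U) = 2%N -> col_span U = col_span U' ->
  exists2 h, h \in unitmx & U = U' *m h.
Proof.
move=> /lker_col_span/eqP/lker0P Uinj UU'.
have /fin_all_exists[w wE] (j : 'I_2) : exists w : 'cV[K]_2, U *m delta_mx j 0 = U' *m w.
  have : U *m delta_mx j 0 \in col_span U'.
    by rewrite -UU'; apply/memv_imgP; exists (delta_mx j 0); rewrite ?memvf ?lfunE.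
  by case/memv_imgP=> w _; rewrite lfunE /= => ->; exists w.
pose h : 'M[K]_2 := \matrix_(i, j) w j i 0.
have UE : U = U' *m h.
  apply/matrixP => i j; have /colP/(_ i) := wE j; rewrite -colE !mxE => ->.
  by apply: eq_bigr => l _; rewrite !mxE.
(* A kernel vector of [h] is a kernel vector of [U], hence zero; [det0P] speaks of row vectors,
   whence the transposes. *)
exists h => //; rewrite unitmxE unitfE -det_tr; apply/det0P => -[y y0 /(congr1 trmx)].
rewrite trmx_mul trmxK trmx0 => hy; case/eqP: y0; apply: trmx_inj; rewrite trmx0.
by apply: Uinj; rewrite !lfunE /= UE -!mulmxA hy !mulmx0.
Qed.

Lemma dim2_det2 U : \dim (col_span U) = 2%N <-> exists i j, det2 (row i U) (row j U) != 0.
Proof.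
have mulE (w : 'cV[K]_2) i : (U *m w) i 0 = U i 0 * w 0 0 + U i 1 * w 1 0.
  rewrite !mxE !big_ord_recl big_ord0 addr0.
  by have -> : lift ord0 ord0 = 1 :> 'I_2 by apply: val_inj.
rewrite lker_col_span; split=> [/eqP/lker0P Uinj|[i [j ij]]]; last first.
  apply/eqP/lker0P => w w'; rewrite !lfunE /= => /eqP; rewrite -subr_eq0 -mulmxBr => /eqP.
  move: (w - w') (subr_eq0 w w') => z zw Uz; apply/eqP; rewrite -zw; apply/eqP.
  have Uz0 l : U l 0 * z 0 0 + U l 1 * z 1 0 = 0 by rewrite -mulE Uz mxE.
  rewrite /det2 !mxE in ij; have /rV2P zT : z^T 0 0 = (0 : 'rV[K]_2) 0 0.
    apply: (mulfI ij); rewrite !mxE mulr0.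
    have -> : (U i 0 * U j 1 - U i 1 * U j 0) * z 0 0 =
      (U i 0 * z 0 0 + U i 1 * z 1 0) * U j 1 - (U j 0 * z 0 0 + U j 1 * z 1 0) * U i 1 by ring.
    by rewrite !Uz0 !mul0r subr0.
  apply: trmx_inj; rewrite trmx0; apply: zT; apply: (mulfI ij); rewrite !mxE mulr0.
  have -> : (U i 0 * U j 1 - U i 1 * U j 0) * z 1 0 =
    U i 0 * (U j 0 * z 0 0 + U j 1 * z 1 0) - U j 0 * (U i 0 * z 0 0 + U i 1 * z 1 0) by ring.
  by rewrite !Uz0 !mulr0 subr0.
have [/existsP[i /existsP[j ij]]|/existsPn allD] :=
    boolP [exists i, exists j, det2 (row i U) (row j U) != 0]; first by exists i, j.
have {}allD i j : det2 (row i U) (row j U) = 0.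
  by move: (allD i) => /existsPn/(_ j); rewrite negbK => /eqP.
suff [w w0 Uw] : exists2 w : 'cV[K]_2, w != 0 & U *m w = 0.
  by case/eqP: w0; apply: Uinj; rewrite !lfunE /= Uw mulmx0.
have [/existsP[i ri]|/existsPn allz] := boolP [exists i, row i U != 0]; last first.
  exists (delta_mx 0 0); last first.
    suff -> : U = 0 by rewrite mul0mx.
    by apply/row_matrixP => i; rewrite row0; apply/eqP; rewrite -[_ == _]negbK allz.
  by apply/eqP => /colP/(_ 0)/eqP; rewrite !mxE oner_eq0.
(* This vector pairs with row [j] to the minor of rows [i] and [j], which vanishes; it is nonzero
   because row [i] is. *)
exists (\col_i0 (if i0 == 0 then - U i 1 else U i 0)).
  apply: contraNneq ri => w0; apply/eqP/rV2P; rewrite !mxE.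
    by move/colP/(_ 1): w0; rewrite !mxE.
  by move/colP/(_ 0): w0; rewrite !mxE /= => /eqP; rewrite oppr_eq0 => /eqP.
apply/colP => j; rewrite mulE; have := allD i j; rewrite /det2 !mxE /= => <-; ring.
Qed.

End ColumnSpans.

(** * Orbits of the Borel subgroup on matrices and equality of row filtrations *)

Section BorelOrbits.
Variables (K : closedFieldType) (p q r : nat).
Local Notation n := (p + q + r)%N.
Local Notation box := (box p q r).
Implicit Types (U : 'M[K]_(n, 2)) (x : box).

Lemma box_index_inj : injective (@box_index p q r).
Proof.
move=> [[i|i]|i] [[j|j]|j] /= /(congr1 val) /=.
- by move/val_inj->.
- by move=> ij; have := ltn_ord i; rewrite ij ltnNge leq_addr.
- by move=> ij; have := ltn_ord i; rewrite ij ltnNge -addnA leq_addr.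
- by move=> ij; have := ltn_ord j; rewrite -ij ltnNge leq_addr.
- by move/addnI/val_inj->.
- by move=> ij; have := ltn_ord i; rewrite -(ltn_add2l p) ij ltnNge leq_addr.
- by move=> ij; have := ltn_ord j; rewrite -ij ltnNge -addnA leq_addr.
- by move=> ij; have := ltn_ord j; rewrite -(ltn_add2l p) -ij ltnNge leq_addr.
- by move/addnI/val_inj->.
Qed.

Lemma box_indexP (i : 'I_n) : exists x, i = box_index x.
Proof.
case: (split_ordP i) => [j ->|j ->]; last by exists (inr j).
by case: (split_ordP j) => [l ->|l ->]; [exists (inl (inl l))|exists (inl (inr l))].
Qed.

Definition box_rows U x : 'rV[K]_2 := row (box_index x) U.

Lemma box_rows_inj U U' : box_rows U =1 box_rows U' -> U = U'.
Proof. by move=> UU'; apply/row_matrixP => i; have [x ->] := box_indexP i; apply: UU'. Qed.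

Lemma box_rows_block U (a : 'M[K]_p) (b : 'M[K]_q) (c : 'M[K]_r) :
  [/\ forall i, box_rows (block_diag (a, b, c) *m U) (inl (inl i)) =
        \sum_j a i j *: box_rows U (inl (inl j)),
      forall i, box_rows (block_diag (a, b, c) *m U) (inl (inr i)) =
        \sum_j b i j *: box_rows U (inl (inr j))
    & forall i, box_rows (block_diag (a, b, c) *m U) (inr i) =
        \sum_j c i j *: box_rows U (inr j)].
Proof.
have rowE (m k : nat) (A : 'M[K]_m) (B : 'M[K]_(m, k)) i :
    row i (A *m B) = \sum_j A i j *: row j B.
  by rewrite row_mul mulmx_sum_row; apply: eq_bigr => j _; rewrite mxE.
have rowu (m1 m2 : nat) (A : 'M[K]_(m1, 2)) (B : 'M[K]_(m2, 2)) i :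
    row (lshift m2 i) (col_mx A B) = row i A by apply/rowP => j; rewrite !mxE (unsplitK (inl _)).
have rowd (m1 m2 : nat) (A : 'M[K]_(m1, 2)) (B : 'M[K]_(m2, 2)) i :
    row (rshift m1 i) (col_mx A B) = row i B by apply/rowP => j; rewrite !mxE (unsplitK (inr _)).
rewrite -[U]vsubmxK -[usubmx U]vsubmxK /block_diag /box_rows /box_index !mul_block_col.
rewrite !mul0mx !addr0 !add0r.
by split=> i; rewrite !(rowu, rowd) rowE; apply: eq_bigr => j _; rewrite !(rowu, rowd).
Qed.

Lemma row_span_tail (u : box -> 'rV[K]_2) (i : nat) :
  [/\ row_span u (@Ordinal 3 0 isT) i = tail_span (fun j : 'I_p => u (inl (inl j))) i,
      row_span u (@Ordinal 3 1 isT) i = tail_span (fun j : 'I_q => u (inl (inr j))) i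
    & row_span u (@Ordinal 3 2 isT) i = tail_span (fun j : 'I_r => u (inr j)) i].
Proof.
rewrite /row_span /tail_span !big_sumType /=.
by rewrite !big_pred0_eq !addv0 !add0v.
Qed.

(** A block diagonal matrix acts on the three rows of boxes separately, so the criterion for tail
    spans applies in each row. *)
Lemma borel_row_span U U' :
  (exists2 g, B_L K p q r g & U = block_diag g *m U') <->
  (forall k i, row_span (box_rows U) k i = row_span (box_rows U') k i).
Proof.
split=> [[[[a b] c] /= [[au bu cu] [at' bt ct]] ->]|UU'].
  have [ua ub uc] := box_rows_block U' a b c.
  move=> k i; have [ra rb rc] := row_span_tail (box_rows U') i.
  have [ra' rb' rc'] := row_span_tail (box_rows (block_diag (a, b, c) *m U')) i.
  case: k => -[|[|[|//]]] k3; rewrite (bool_irrelevance k3 isT).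
  - by rewrite ra ra'; apply: trig_tail_span_eq at' _ _.
  - by rewrite rb rb'; apply: trig_tail_span_eq bt _ _.
  - by rewrite rc rc'; apply: trig_tail_span_eq ct _ _.
(* The hypothesis on [row_span] is rewritten as an equality of tail spans, once for each row of the
   diagram. *)
have [a [au at' aE]] := @tail_span_eq_trig _ _ _ (fun j : 'I_p => box_rows U (inl (inl j)))
  (fun j : 'I_p => box_rows U' (inl (inl j))) (fun i => let: And3 e _ _ := row_span_tail _ i in
   let: And3 e' _ _ := row_span_tail _ i in etrans (esym e) (etrans (UU' _ i) e')).
have [b [bu bt bE]] := @tail_span_eq_trig _ _ _ (fun j : 'I_q => box_rows U (inl (inr j)))
  (fun j : 'I_q => box_rows U' (inl (inr j))) (fun i => let: And3 _ e _ := row_span_tail _ i in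
   let: And3 _ e' _ := row_span_tail _ i in etrans (esym e) (etrans (UU' _ i) e')).
have [c [cu ct cE]] := @tail_span_eq_trig _ _ _ (fun j : 'I_r => box_rows U (inr j))
  (fun j : 'I_r => box_rows U' (inr j)) (fun i => let: And3 _ _ e := row_span_tail _ i in
   let: And3 _ _ e' := row_span_tail _ i in etrans (esym e) (etrans (UU' _ i) e')).
exists (a, b, c) => //; apply: box_rows_inj; have [ua ub uc] := box_rows_block U' a b c.
by case=> [[i|i]|i]; rewrite ?ua ?ub ?uc ?aE ?bE ?cE.
Qed.

End BorelOrbits.

(** * Bases of the planes attached to gray and to black diagrams *)

Section NormalForms.
Variables (K : closedFieldType) (p q r : nat).
Local Notation n := (p + q + r)%N.
Local Notation box := (box p q r).
Implicit Types (u : box -> 'rV[K]_2) (x y t : box) (S : {set box}) (v : 'cV[K]_n).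

Definition point (a b : K) : 'rV[K]_2 := \row_j (if j == 0 then a else b).

Lemma det2_point a b c d : det2 (point a b) (point c d) = a * d - b * c.
Proof. by rewrite /det2 !mxE. Qed.

Lemma box_rows_pair v1 v2 x :
  box_rows (col_pair v1 v2) x = point (v1 (box_index x) 0) (v2 (box_index x) 0).
Proof. by apply/rowP => j; rewrite !mxE. Qed.

Lemma e_E x y : (e_ K y) (box_index x) 0 = (x == y)%:R.
Proof. by rewrite mxE eqxx andbT (inj_eq (@box_index_inj p q r)). Qed.

Lemma sum_e_E S x : (\sum_(y in S) e_ K y) (box_index x) 0 = (x \in S)%:R.
Proof.
rewrite summxE; under eq_bigr => y _ do rewrite e_E.
have [xS|xS] := boolP (x \in S); last first.
  by rewrite big1 // => y yS; have /negPf-> : x != y by apply: contraNneq xS => ->.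
by rewrite (bigD1 x) //= eqxx big1 ?addr0 // => y /andP[_ /negPf]; rewrite eq_sym => ->.
Qed.

(** Exactly the hypotheses of [jumps_normal_form], so that such a [u] has jump set [S]. *)
Definition normal_form u S : Prop :=
  [/\ forall x, x \notin S -> u x = 0, forall k, (#|in_row S k| <= 2)%N,
      forall x, x \in S -> u x != 0
    & forall x y, x \in S -> y \in S -> x != y -> box_row x = box_row y ->
       det2 (u x) (u y) != 0].

Definition diag_support (eta : colored_diagram p q r) : {set box} :=
  match eta with Gray P _ => cover P | Black T _ => T end.

Definition same_block (P : {set {set box}}) x y : bool :=
  [exists T in P, (x \in T) && (y \in T)].

Lemma gray_pairP (P : {set {set box}}) : gray_pair P ->
  exists S1 S2, [/\ P = [set S1; S2], S1 != S2, [disjoint S1 & S2],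
    S1 != set0 /\ S2 != set0
    & forall k, (#|in_row S1 k| <= 1)%N && (#|in_row S2 k| <= 1)%N].
Proof.
case/and4P=> /cards2P[S1 [S2 [S12 PE]]] P0 /trivIsetP Ptriv /'forall_implyP Prow.
have S1P : S1 \in P by rewrite PE !inE eqxx.
have S2P : S2 \in P by rewrite PE !inE eqxx orbT.
exists S1, S2; split=> //; first exact: Ptriv.
  by split; apply: contraNneq P0 => <-.
by move=> k; rewrite (forallP (Prow _ S1P)) (forallP (Prow _ S2P)).
Qed.

Lemma in_row_le1_inj S x y : (forall k, #|in_row S k| <= 1)%N ->
  x \in S -> y \in S -> box_row x = box_row y -> x = y.
Proof.
move=> /(_ (box_row x))/card_le1_eqP S1 xS yS xy; apply: S1; rewrite inE ?xS ?yS ?xy //=.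
Qed.

Lemma same_block_pair S1 S2 x y : [disjoint S1 & S2] ->
  x \in S1 :|: S2 -> y \in S1 :|: S2 ->
  same_block [set S1; S2] x y = ((x \in S1) == (y \in S1)).
Proof.
move=> dis; rewrite !inE => xS yS; apply/existsP/idP => [[T]|/eqP xy].
  rewrite !inE => /andP[/orP[]/eqP-> /andP[xT yT]]; first by rewrite xT yT.
  by rewrite !(disjointFl dis).
have [x1|x1] := boolP (x \in S1); first by exists S1; rewrite !inE eqxx -xy x1.
exists S2; rewrite !inE eqxx orbT /=.
by move: xS yS; rewrite -xy (negPf x1) /= => -> ->.
Qed.

Lemma cover_pair S1 S2 : S1 != S2 -> cover [set S1; S2] = S1 :|: S2.
Proof. by move=> S12; rewrite /cover big_setU1 ?inE //= big_set1. Qed.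

(** In the basis formed by the two block sums, the boxes of [S1] have coordinates (1,0), those of
    [S2] have (0,1) and all others (0,0); determinants thus vanish exactly within a block. *)
Lemma gray_basis (P : {set {set box}}) (grayP : gray_pair P) :
  exists v1 v2, let u := box_rows (col_pair v1 v2) in
  [/\ M_ K (Gray grayP) = col_span (col_pair v1 v2), normal_form u (cover P),
      exists x y, det2 (u x) (u y) != 0
    & {in cover P &, forall x y, (det2 (u x) (u y) == 0) = same_block P x y}].
Proof.
have [S1 [S2 [PE S12 dis [S10 S20] Srow]]] := gray_pairP grayP.
have covE : cover P = S1 :|: S2 by rewrite PE cover_pair.
exists (\sum_(x in S1) e_ K x), (\sum_(x in S2) e_ K x); move=> /=.
have uE x : box_rows (col_pair (\sum_(x in S1) e_ K x) (\sum_(x in S2) e_ K x)) x =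
    point (x \in S1)%:R (x \in S2)%:R by rewrite box_rows_pair !sum_e_E.
have S2E x : x \in cover P -> (x \in S2) = (x \notin S1).
  rewrite covE inE; have [x1 _|x1 /= ->//] := boolP (x \in S1).
  by rewrite (disjointFr dis x1).
have blockE x y : x \in cover P -> y \in cover P ->
    same_block P x y = ((x \in S1) == (y \in S1)).
  by rewrite covE PE; apply: same_block_pair.
have detE x y : x \in cover P -> y \in cover P ->
    (det2 (point (x \in S1)%:R (x \in S2)%:R) (point (y \in S1)%:R (y \in S2)%:R) == 0 :> K)
      = same_block P x y.
  move=> xP yP; rewrite blockE // det2_point !S2E //.
  by do 2!case: (_ \in S1) => /=;
    rewrite ?(mulr0, mul0r, mulr1, subr0, sub0r, oppr_eq0) ?eqxx ?oner_eq0.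
split.
- by rewrite col_span_pair /M_ /gray_space PE big_setU1 ?inE //= big_set1.
- split=> [x|k|x|x y].
  + by rewrite covE inE negb_or uE => /andP[/negPf-> /negPf->]; apply/rowP => j; rewrite !mxE if_same.
  + have -> : in_row (cover P) k = in_row S1 k :|: in_row S2 k.
      by apply/setP => x; rewrite covE !inE andb_orl.
    by rewrite (leq_trans (leq_card_setU _ _)) //; have /andP[a b] := Srow k; rewrite (leq_add a b).
  + rewrite uE covE inE => xS; apply/eqP => /rowP u0.
    case/orP: xS => xS; [move: (u0 0)|move: (u0 1)]; rewrite !mxE /= xS => /eqP;
      by rewrite oner_eq0.
  + rewrite !uE => xP yP nxy xy; rewrite detE // blockE //; apply: contraNneq nxy => S1xy.
    move: xP yP; rewrite covE !inE -S1xy; have [x1 _ _|x1 /= x2 y2] := boolP (x \in S1).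
      by apply/eqP; apply: (in_row_le1_inj _ x1 _ xy) => [k|]; [case/andP: (Srow k)|rewrite -S1xy].
    by apply/eqP; apply: (in_row_le1_inj _ x2 y2 xy) => k; case/andP: (Srow k).
- case/set0Pn: S10 => x x1; case/set0Pn: S20 => y y2; exists x, y; rewrite !uE.
  by rewrite detE ?blockE ?covE ?inE ?x1 ?y2 ?orbT // (disjointFl dis y2).
- by move=> x y xP yP; rewrite !uE detE.
Qed.

Lemma row_boxes_spec S k : (1 <= #|in_row S k| <= 2)%N ->
  (#|in_row S k| = 1%N /\ exists t, row_boxes S k = [:: t] /\ in_row S k = [set t]) \/
  (#|in_row S k| = 2%N /\ exists x t,
     [/\ row_boxes S k = [:: x; t], in_row S k = [set x; t] & (box_col x < box_col t)%N]).
Proof.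
have rbE : in_row S k =i row_boxes S k by move=> x; rewrite mem_sort mem_enum.
have szE : #|in_row S k| = size (row_boxes S k) by rewrite size_sort cardE.
have srt : sorted (fun x y : box => box_col x <= box_col y)%N (row_boxes S k).
  by apply: sort_sorted => x y; apply: leq_total.
have uni : uniq (row_boxes S k) by rewrite sort_uniq enum_uniq.
rewrite szE; case: (row_boxes S k) rbE srt uni szE => [|x [|t [|//]]] //= rbE srt uni szE _.
  by left; split=> //; exists x; split=> //; apply/setP => y; rewrite rbE !inE.
right; split=> //; exists x, t; split=> //; first by apply/setP => y; rewrite rbE !inE.
move: srt uni; rewrite andbT inE andbT leq_eqVlt => /orP[/eqP xt|//] /eqP[].
have: x \in in_row S k by rewrite rbE !inE eqxx.
have: t \in in_row S k by rewrite rbE !inE eqxx orbT.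
rewrite !inE => /andP[_ /eqP tk] /andP[_ /eqP xk].
by apply: box_inj; rewrite ?tk.
Qed.

Lemma sorted_rows_spec S : exists k0 k1 k2, [/\ sorted_rows S = [:: k0; k1; k2],
  uniq [:: k0; k1; k2], (forall k, k \in [:: k0; k1; k2]),
  (#|in_row S k0| <= #|in_row S k1|)%N & (#|in_row S k1| <= #|in_row S k2|)%N].
Proof.
have szE : size (sorted_rows S) = 3 by rewrite size_sort size_enum_ord.
have uni : uniq (sorted_rows S) by rewrite sort_uniq enum_uniq.
have srE k : k \in sorted_rows S by rewrite mem_sort mem_enum.
set le := (fun k l : 'I_3 => (#|in_row S k| < #|in_row S l|) ||
  ((#|in_row S k| == #|in_row S l|) && (k <= l)))%N.
have srt : sorted le (sorted_rows S).
  apply: sort_sorted => k l; rewrite /le [in X in _ || X]eq_sym.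
  by case: ltngtP => //= _; rewrite leq_total.
have leE k l : le k l -> (#|in_row S k| <= #|in_row S l|)%N.
  by case/orP=> [/ltnW|/andP[/eqP->]].
case: (sorted_rows S) szE uni srE srt => [|k0 [|k1 [|k2 [|//]]]] //= _ uni srE.
by case/and3P=> /leE k01 /leE k12 _; exists k0, k1, k2; split.
Qed.

Lemma card_in_rows S k0 k1 k2 : uniq [:: k0; k1; k2] -> (forall k, k \in [:: k0; k1; k2]) ->
  #|S| = (#|in_row S k0| + #|in_row S k1| + #|in_row S k2|)%N.
Proof.
move=> uni kE; rewrite -sum1_card (partition_big (@box_row p q r) xpredT) //=.
transitivity (\sum_(k <- [:: k0; k1; k2]) #|in_row S k|)%N.
  rewrite (big_uniq _ uni); apply: eq_big => [k|k _]; first by rewrite kE.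
  by rewrite sum1dep_card; apply: eq_card => x; rewrite !inE.
by rewrite !big_cons big_nil addn0 addnA.
Qed.

(** In both cases [t] is the last box of [S] in row [k], whose vector gives the point of that
    row. *)
Definition row_form u S k t : Prop :=
  (in_row S k = [set t] /\ u t != 0) \/
  (exists x, [/\ in_row S k = [set x; t], (box_col x < box_col t)%N & det2 (u x) (u t) != 0]).

(** Reduces each black diagram to one check per row and the pairwise independence of the three last
    boxes. *)
Lemma row_forms_normal u S k0 k1 k2 t0 t1 t2 :
  (forall k, k \in [:: k0; k1; k2]) -> (forall x, x \notin S -> u x = 0) ->
  row_form u S k0 t0 -> row_form u S k1 t1 -> row_form u S k2 t2 ->
  det2 (u t0) (u t1) != 0 -> det2 (u t0) (u t2) != 0 -> det2 (u t1) (u t2) != 0 ->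
  normal_form u S /\
  (forall x y, is_top S x -> is_top S y -> box_row x != box_row y -> det2 (u x) (u y) != 0).
Proof.
move=> kE u0 f0 f1 f2 d01 d02 d12.
pose t k := if k == k0 then t0 else if k == k1 then t1 else t2.
have form k : row_form u S k (t k).
  rewrite /t; have := kE k; rewrite !inE.
  by case: eqP => [->|_] //=; case: eqP => [->|_] //= /eqP->.
have dt k l : k != l -> det2 (u (t k)) (u (t l)) != 0.
  have := kE k; have := kE l; rewrite /t !inE.
  case: (eqVneq k k0) => [->|_] /=; case: (eqVneq l k0) => [->|_] /=; rewrite ?eqxx //.
  - by case: eqP.
  - by rewrite det2C_eq0; case: eqP.
  case: (eqVneq k k1) => [->|_] /=; case: (eqVneq l k1) => [->|_] //=; rewrite ?eqxx //.
  - by rewrite det2C_eq0.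
  - by move=> /eqP-> /eqP->; rewrite eqxx.
have topE x : is_top S x -> x = t (box_row x).
  move=> xT; have xS := is_top_mem xT; have xk : x \in in_row S (box_row x) by rewrite inE xS /=.
  case: (form (box_row x)) => [[rE _]|[y [rE yt _]]]; move: (xk); rewrite rE !inE; first by move/eqP.
  case/orP=> /eqP // xy; move: yt; rewrite -xy.
  have : t (box_row x) \in in_row S (box_row x) by rewrite rE !inE eqxx orbT.
  rewrite inE => /andP[tS /eqP tk]; case/andP: xT => _ /'forall_implyP/(_ _ tS)/implyP.
  by rewrite tk eqxx => /(_ isT); rewrite leqNgt => /negPf->.
split=> [|x y /topE xE /topE yE xy]; last by rewrite xE yE dt.
split=> // [k|x xS|x y xS yS nxy xy].
- by case: (form k) => [[-> _]|[x [-> _ _]]]; rewrite ?cards1 // cards2 ltnS leq_b1.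
- have : x \in in_row S (box_row x) by rewrite inE xS /=.
  case: (form (box_row x)) => [[-> tn0]|[y [-> _ /det2_neq0[yn0 tn0]]]]; rewrite !inE.
    by move/eqP->.
  by case/orP=> /eqP->.
- have : x \in in_row S (box_row x) by rewrite inE xS /=.
  have : y \in in_row S (box_row x) by rewrite inE yS xy /=.
  move: (t (box_row x)) (form (box_row x)) => w [[-> _]|[z [-> _ dz]]]; rewrite !inE.
    by move=> /eqP yt /eqP xt; case/eqP: nxy; rewrite xt yt.
  move: nxy => /[swap] /orP[]/eqP-> /[swap] /orP[]/eqP->; rewrite ?eqxx // => _.
  by rewrite det2C_eq0.
Qed.

Lemma point0 : point 0 0 = 0.
Proof. by apply/rowP => j; rewrite !mxE if_same. Qed.

Lemma point_neq0 a b : (point a b != 0) = (a != 0) || (b != 0).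
Proof.
rewrite -negb_and; congr (~~ _); apply/eqP/andP => [/rowP p0|[/eqP-> /eqP->]].
  by move: (p0 0) (p0 1); rewrite !mxE /= => -> ->.
exact: point0.
Qed.

Lemma col_addE (v w : 'cV[K]_n) i : (v + w) i 0 = v i 0 + w i 0.
Proof. by rewrite mxE. Qed.

Lemma col_oppE (v : 'cV[K]_n) i : (- v) i 0 = - v i 0.
Proof. by rewrite mxE. Qed.

Lemma neq_box_row k l x y : k != l -> box_row x = k -> box_row y = l -> (x == y) = false.
Proof. by move=> kl xk yl; apply: contraNF kl => /eqP xy; rewrite -xk -yl xy. Qed.

Lemma neq_box_col x y : (box_col x < box_col y)%N -> (x == y) = false.
Proof. by move=> xy; apply: contraTF xy => /eqP->; rewrite ltnn. Qed.

Lemma neq_notin S x y : x \notin S -> y \in S -> (x == y) = false.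
Proof. by move=> xS yS; apply: contraNF xS => /eqP->. Qed.

(** Decides equalities between named boxes: distinct ones are separated by their rows, by their
    columns, or by membership in a set. *)
Ltac eval_boxes := repeat match goal with
  | |- context [?a == ?a] => rewrite (eqxx a)
  | H : box_row ?a = ?k, H' : box_row ?b = ?l, N : is_true (?k != ?l) |- context [?a == ?b] =>
    rewrite (neq_box_row N H H')
  | H : box_row ?a = ?k, H' : box_row ?b = ?l, N : is_true (?k != ?l) |- context [?b == ?a] =>
    rewrite (eq_sym b a) (neq_box_row N H H')
  | H : is_true (box_col ?a < box_col ?b)%N |- context [?a == ?b] => rewrite (neq_box_col H)
  | H : is_true (box_col ?a < box_col ?b)%N |- context [?b == ?a] =>
    rewrite (eq_sym b a) (neq_box_col H)
  | H : is_true (?a \notin ?T), H' : is_true (?b \in ?T) |- context [?a == ?b] =>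
    rewrite (neq_notin H H')
  end.

Ltac eval_point := rewrite box_rows_pair !(col_addE, col_oppE, e_E); eval_boxes;
  by rewrite ?(mulr0n, mulr1n, addr0, add0r, oppr0).

Ltac eval_det2 :=
  by rewrite ?det2_point ?point_neq0 ?(mulr0, mul0r, mulr1, mul1r, subr0, sub0r,
    oppr0, oppr_eq0, oner_eq0, eqxx).

(** The vectors chosen for each size of [S] give the last boxes of the three rows pairwise
    independent coordinates, and likewise the two boxes of a row that has two. *)
Lemma black_basis (charK0 : [pchar K] =i pred0) S (blackS : black_set S) :
  exists v1 v2, let u := box_rows (col_pair v1 v2) in
  [/\ M_ K (Black blackS) = col_span (col_pair v1 v2), normal_form u S,
      exists x y, det2 (u x) (u y) != 0
    & forall x y, is_top S x -> is_top S y -> box_row x != box_row y -> det2 (u x) (u y) != 0].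
Proof.
(* The determinant of (1,1) and (1,-1), which occurs for four boxes; the characteristic of [K]
   enters here. *)
have two_neq0 : -1 - 1 != 0 :> K.
  rewrite -opprD oppr_eq0 -mulr2n; have := charK0 2; rewrite !inE /= => ->//.
have one_neq0 := oner_neq0 K; have mone_neq0 : -1 != 0 :> K by rewrite oppr_eq0.
have [k0 [k1 [k2 [srE uni kE c01 c12]]]] := sorted_rows_spec S.
have cE := card_in_rows S uni kE.
suff [v1 [v2 [ME [t0 [t1 [t2 [u0 [f0 f1 f2] [d01 d02 d12]]]]]]]] : exists v1 v2,
    let u := box_rows (col_pair v1 v2) in black_space K S = (<[v1]> + <[v2]>)%VS /\
    exists t0 t1 t2, [/\ forall x, x \notin S -> u x = 0,
      [/\ row_form u S k0 t0, row_form u S k1 t1 & row_form u S k2 t2] &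
      [/\ det2 (u t0) (u t1) != 0, det2 (u t0) (u t2) != 0 & det2 (u t1) (u t2) != 0]].
  have [nf tD] := row_forms_normal kE u0 f0 f1 f2 d01 d02 d12.
  by exists v1, v2; split=> //; [rewrite col_span_pair|exists t0, t1].
have memS k t (T : {set box}) : in_row S k = T -> t \in T -> t \in S /\ box_row t = k.
  by move=> <-; rewrite inE => /andP[tS /eqP tk].
move: uni; rewrite /= !inE negb_or andbT => /andP[/andP[n01 n02] n12].
have blackk k : (1 <= #|in_row S k| <= 2)%N by apply: (forallP blackS).
rewrite /black_space srE /= cE.
(* Of the eight choices of one or two boxes per row, the inequalities [c01] and [c12] leave four,
   with 3, 4, 5 and 6 boxes in this order. *)
case: (row_boxes_spec (blackk k2)) c12 => [[c2 [z [r2 i2]]]|[c2 [z [z' [r2 i2 zz]]]]];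
case: (row_boxes_spec (blackk k1)) c01 => [[c1 [y [r1 i1]]]|[c1 [y [y' [r1 i1 yy]]]]];
case: (row_boxes_spec (blackk k0)) => [[c0 [x [r0 i0]]]|[c0 [x [x' [r0 i0 xx]]]]];
rewrite c0 c1 c2 r0 r1 r2 //= => _ _.
all: have [xS xk] := memS _ x _ i0 ltac:(by rewrite !inE eqxx).
all: have [yS yk] := memS _ y _ i1 ltac:(by rewrite !inE eqxx).
all: have [zS zk] := memS _ z _ i2 ltac:(by rewrite !inE eqxx).
all: try have [xS' xk'] := memS _ x' _ i0 ltac:(by rewrite !inE eqxx orbT).
all: try have [yS' yk'] := memS _ y' _ i1 ltac:(by rewrite !inE eqxx orbT).
all: try have [zS' zk'] := memS _ z' _ i2 ltac:(by rewrite !inE eqxx orbT).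
(* The two spanning vectors are read off [black_space] by unification. *)
all: do 2!eexists; split; first by reflexivity.
all: set u := box_rows _.
- have ux : u x = point 1 0 by rewrite /u; eval_point.
  have uy : u y = point 1 1 by rewrite /u; eval_point.
  have uz : u z = point 0 1 by rewrite /u; eval_point.
  (* Here and in the next three cases the witnesses are the last boxes of the rows, so primed ones
     where a row has two. *)
  exists x, y, z; split=> [b bS||]; first (by rewrite -point0 /u; eval_point).
    by split; left; split; rewrite ?ux ?uy ?uz //; eval_det2.
  by split; rewrite ?ux ?uy ?uz; eval_det2.
- have ux : u x = point 1 1 by rewrite /u; eval_point.
  have uy : u y = point 1 (-1) by rewrite /u; eval_point.
  have uz : u z = point 1 0 by rewrite /u; eval_point.
  have uz' : u z' = point 0 1 by rewrite /u; eval_point.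
  exists x, y, z'; split=> [b bS||]; first (by rewrite -point0 /u; eval_point).
    split; [left|left|right; exists z]; split; rewrite // ?ux ?uy ?uz ?uz'; eval_det2.
  by split; rewrite ?ux ?uy ?uz'; eval_det2.
- have ux : u x = point 1 1 by rewrite /u; eval_point.
  have uy : u y = point 1 0 by rewrite /u; eval_point.
  have uy' : u y' = point 0 1 by rewrite /u; eval_point.
  have uz : u z = point 0 1 by rewrite /u; eval_point.
  have uz' : u z' = point 1 0 by rewrite /u; eval_point.
  exists x, y', z'; split=> [b bS||]; first (by rewrite -point0 /u; eval_point).
    split; [left|right; exists y|right; exists z]; split; rewrite // ?ux ?uy ?uy' ?uz ?uz'; eval_det2.
  by split; rewrite ?ux ?uy' ?uz'; eval_det2.
- have ux : u x = point 1 0 by rewrite /u; eval_point.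
  have ux' : u x' = point 0 1 by rewrite /u; eval_point.
  have uy : u y = point 0 1 by rewrite /u; eval_point.
  have uy' : u y' = point 1 0 by rewrite /u; eval_point.
  have uz : u z = point 0 1 by rewrite /u; eval_point.
  have uz' : u z' = point 1 1 by rewrite /u; eval_point.
  exists x', y', z'; split=> [b bS||]; first (by rewrite -point0 /u; eval_point).
    split; right; [exists x|exists y|exists z]; split;
      rewrite // ?ux ?ux' ?uy ?uy' ?uz ?uz'; eval_det2.
  by split; rewrite ?ux' ?uy' ?uz'; eval_det2.
Qed.

End NormalForms.

(** * Recovering a colored diagram from its support and its coincidence pattern *)

Section Patterns.
Variables (p q r : nat).
Local Notation box := (box p q r).
Implicit Types (P : {set {set box}}) (S : {set box}) (x y : box).

Lemma gray_pair_intro S1 S2 : S1 != set0 -> S2 != set0 -> [disjoint S1 & S2] ->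
  (forall k, #|in_row S1 k| <= 1)%N -> (forall k, #|in_row S2 k| <= 1)%N ->
  S1 != S2 /\ gray_pair [set S1; S2].
Proof.
move=> S10 S20 dis r1 r2.
have S12 : S1 != S2.
  apply: contraNneq S10 => S12; move: dis; rewrite -S12 -setI_eq0 setIid => /eqP->.
  by rewrite eqxx.
split=> //; apply/and4P; split; first by rewrite cards2 S12.
- by rewrite !inE !negb_or eq_sym S10 eq_sym S20.
- apply/trivIsetP => A B; rewrite !inE => /orP[]/eqP-> /orP[]/eqP->; rewrite ?eqxx //.
  by rewrite disjoint_sym.
apply/'forall_implyP => A; rewrite !inE => /orP[]/eqP->; apply/forallP => k.
  exact: r1.
exact: r2.
Qed.

(* Two distinct boxes of a row lie in different blocks, so [same_block] is
   determined by its values on one box per row. *)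
Lemma same_block_row P x y x' y' : gray_pair P ->
    x \in cover P -> y \in cover P -> x' \in cover P -> y' \in cover P ->
    box_row x = box_row x' -> box_row y = box_row y' ->
  same_block P x y = same_block P x' y' (+) (x != x') (+) (y != y').
Proof.
case/gray_pairP=> S1 [S2 [-> S12 dis _ Srow]]; rewrite cover_pair // => xS yS xS' yS' xx yy.
rewrite !same_block_pair //.
have flip z z' : z \in S1 :|: S2 -> z' \in S1 :|: S2 -> box_row z = box_row z' ->
    (z \in S1) = (z' \in S1) (+) (z != z').
  move=> zS zS' zz; have [->|nz] := eqVneq z z'; first by rewrite addbF.
  rewrite addbT; apply/idP/idP => [z1|z'1].
    apply: contraNN nz => z'1; apply/eqP; apply: (in_row_le1_inj _ z1 z'1 zz) => k.
    by case/andP: (Srow k).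
  apply: contraTT zS => z1; apply: contraNN nz; rewrite inE (negPf z1) /= => z2.
  move: zS'; rewrite inE (negPf z'1) /= => z'2.
  by apply/eqP; apply: (in_row_le1_inj _ z2 z'2 zz) => k; case/andP: (Srow k).
rewrite (flip x x') // (flip y y') //.
by case: (x' \in S1); case: (y' \in S1); case: (x != x'); case: (y != y').
Qed.

(** The blocks are the classes of [same_block], and both occur because both sets are nonempty; an
    unordered pair is thus determined by its cover and this relation. *)
Lemma gray_blocks P : gray_pair P ->
  P = [set [set y in cover P | same_block P x y] | x in cover P].
Proof.
case/gray_pairP=> S1 [S2 [-> S12 dis [S10 S20] _]]; rewrite cover_pair //.
have bE x : x \in S1 :|: S2 ->
    [set y in S1 :|: S2 | same_block [set S1; S2] x y] = if x \in S1 then S1 else S2.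
  move=> xS; apply/setP => y; rewrite inE; have [yS|yS] /= := boolP (y \in S1 :|: S2).
    rewrite same_block_pair //; case: (x \in S1); case: (boolP (y \in S1)) => //= y1.
      by rewrite (disjointFr dis y1).
    by move: yS; rewrite inE (negPf y1) /= => ->.
  by move: yS; rewrite inE negb_or => /andP[/negPf y1 /negPf y2]; case: ifP; rewrite ?y1 ?y2.
apply/setP => A; apply/idP/imsetP => [|[x xS ->]]; last first.
  by rewrite bE // !inE; case: ifP; rewrite eqxx ?orbT.
rewrite !inE => /orP[]/eqP->.
  case/set0Pn: S10 => x x1; exists x; first by rewrite inE x1.
  by rewrite bE ?inE x1.
case/set0Pn: S20 => x x2; exists x; first by rewrite inE x2 orbT.
by rewrite bE ?inE ?x2 ?orbT // (disjointFl dis x2).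
Qed.

(* The coincidence pattern of the lines of [M_eta], read on the top boxes of its
   support, where it is compared with [det2]. *)
Definition collinear (eta : colored_diagram p q r) x y : bool :=
  match eta with Gray P _ => same_block P x y | Black _ _ => box_row x == box_row y end.

Lemma black_row_top S k : black_set S -> exists2 x, is_top S x & box_row x = k.
Proof.
move=> /forallP/(_ k)/andP[+ _]; rewrite card_gt0 => /set0Pn[x]; rewrite inE => /andP[xS /eqP <-].
exact: is_top_exists.
Qed.

(** Pigeonhole: of the three last boxes of a black set, two fall in the same one of two blocks. *)
Lemma gray_not_black P S (gP : gray_pair P) (bS : black_set S) : cover P = S ->
  ~ (forall x y, is_top S x -> is_top S y -> same_block P x y = (box_row x == box_row y)).
Proof.
case/gray_pairP: (gP) => S1 [S2 [-> S12 dis _ _]]; rewrite cover_pair // => SE same.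
have [x xT x0] := black_row_top (inord 0) bS; have [y yT y1] := black_row_top (inord 1) bS.
have [z zT z2] := black_row_top (inord 2) bS.
have memS t : is_top S t -> t \in S1 :|: S2 by rewrite SE; apply: is_top_mem.
move: (same x y xT yT) (same x z xT zT) (same y z yT zT).
rewrite !same_block_pair ?memS // x0 y1 z2 -!val_eqE /= !inordK //=.
by do 3!case: (_ \in S1).
Qed.

(** For two gray diagrams [same_block_row] extends the agreement from top boxes to the whole
    support; a gray and a black diagram are separated by [gray_not_black]. *)
Lemma collinear_inj (eta eta' : colored_diagram p q r) : diag_support eta = diag_support eta' ->
    (forall x y, is_top (diag_support eta) x -> is_top (diag_support eta) y ->
       collinear eta x y = collinear eta' x y) ->
  eta = eta'.
Proof.
case: eta eta' => [P gP|T bT] [P' gP'|T' bT'] /= SE same.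
- suff PE : P = P' by case: _ / PE gP' {SE same} => gP'; rewrite (bool_irrelevance gP gP').
  rewrite (gray_blocks gP) (gray_blocks gP') -SE; apply: eq_in_imset => x xS.
  apply/setP => y; rewrite !inE; have [yS|] //= := boolP (y \in cover P).
  have [x' xT xx] := is_top_exists xS; have [y' yT yy] := is_top_exists yS.
  have xS' := is_top_mem xT; have yS' := is_top_mem yT.
  rewrite (same_block_row gP xS yS xS' yS') ?xx ?yy //.
  by rewrite (same_block_row gP' (x' := x') (y' := y')) -?SE ?xx ?yy ?same.
- by case: (gray_not_black gP bT' SE); rewrite -SE.
- by case: (gray_not_black gP' bT (esym SE)) => x y xT yT; rewrite same.
- by case: _ / SE bT' {same} => bT'; rewrite (bool_irrelevance bT bT').
Qed.

End Patterns.

(** * Existence and uniqueness of the diagram of a Borel orbit *)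

Section BorelBijection.
Variables (K : closedFieldType) (charK0 : [pchar K] =i pred0) (p q r : nat).
Local Notation n := (p + q + r)%N.
Local Notation box := (box p q r).
Implicit Types (u : box -> 'rV[K]_2) (x y : box) (eta : colored_diagram p q r).

Lemma diagram_basis eta : exists U : 'M[K]_(n, 2),
  [/\ M_ K eta = col_span U, jumps (box_rows U) = diag_support eta, \dim (col_span U) = 2%N
    & forall x y, is_top (diag_support eta) x -> is_top (diag_support eta) y ->
        (det2 (box_rows U x) (box_rows U y) == 0) = collinear eta x y].
Proof.
have nfJ u S : normal_form u S -> jumps u = S by case; apply: jumps_normal_form.
have dim2 (U : 'M[K]_(n, 2)) : (exists x y, det2 (box_rows U x) (box_rows U y) != 0) ->
    \dim (col_span U) = 2%N.
  by case=> x [y xy]; apply/dim2_det2; exists (box_index x), (box_index y).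
case: eta => [P gP|S bS].
  have [v1 [v2 [ME nf D sb]]] := gray_basis K gP; exists (col_pair v1 v2).
  by split; rewrite ?(nfJ _ _ nf) ?dim2 // => x y /is_top_mem xS /is_top_mem yS; apply: sb.
have [v1 [v2 [ME nf D tD]]] := black_basis charK0 bS; exists (col_pair v1 v2).
split; rewrite ?(nfJ _ _ nf) ?dim2 // => x y xT yT /=.
have [xy|xy] := eqVneq (box_row x) (box_row y); last by apply/negbTE/tD.
by rewrite (is_top_uniq xT yT xy) det2aa eqxx.
Qed.

(** Three points are pairwise distinct or take at most two values; in the second case two colors
    record the coincidences. Absent points, given by zero vectors, carry an arbitrary color. *)
Lemma pattern_coloring (a : 'I_3 -> 'rV[K]_2) :
  (forall k l, k != l -> det2 (a k) (a l) != 0) \/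
  exists c : 'I_3 -> bool, forall k l, a k != 0 -> a l != 0 ->
    (det2 (a k) (a l) == 0) = (c k == c l).
Proof.
have [/'forall_forallP black|/forallPn[k1 /forallPn[l1]]] :=
    boolP [forall k, forall l, (k != l) ==> (det2 (a k) (a l) != 0)].
  by left=> k l; apply/implyP.
rewrite negb_imply negbK => /andP[kl1 dkl1]; right.
have [/existsP[k0 /existsP[l0 d0]]|/existsPn allD] :=
    boolP [exists k, exists l, det2 (a k) (a l) != 0]; last first.
  by exists xpred0 => k l _ _; move: (allD k) => /existsPn/(_ l); rewrite negbK.
(* The color tells whether a point differs from the fixed point [a k0]. *)
exists (fun k => det2 (a k0) (a k) != 0) => k l ak al.
have a0 : a k0 != 0 by have [] := det2_neq0 d0.
have [/eqP dk|dk] /= := boolP (det2 (a k0) (a k) == 0).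
  apply/idP/idP => [/eqP dkl|]; first by rewrite (det2_trans ak dk dkl) eqxx.
  rewrite eq_sym eqbF_neg negbK => /eqP d0l; apply/eqP/(det2_trans a0 _ d0l).
  by apply/eqP; rewrite det2C_eq0 dk.
have [/eqP dl|dl] /= := boolP (det2 (a k0) (a l) == 0).
  apply/negbTE; apply: contraNneq dk => dkl; apply/eqP/(det2_trans al dl).
  by apply/eqP; rewrite det2C_eq0 dkl.
(* If [a k] and [a l] both differed from [a k0] and from each other, the three points would be
   pairwise distinct, against the coincidence of [k1] and [l1]. *)
rewrite eqxx; apply: contraTT dkl1 => dkl.
have n0k : k0 != k by apply: contraNneq dk => ->; rewrite det2aa.
have n0l : k0 != l by apply: contraNneq dl => ->; rewrite det2aa.
have nkl : k != l by apply: contraNneq dkl => ->; rewrite det2aa.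
have [m [_ _ cov]] := ord3_third n0k.
have {}cov j : [|| j == k0, j == k | j == l].
  have := cov l; rewrite eq_sym (negPf n0l) eq_sym (negPf nkl) /= => /eqP->; exact: cov.
move: kl1; case/or3P: (cov k1) => /eqP->; case/or3P: (cov l1) => /eqP->; rewrite ?eqxx //.
- by rewrite det2C_eq0.
- by rewrite det2C_eq0.
- by rewrite det2C_eq0.
Qed.

Lemma nontop_uniq S x y : (#|in_row S (box_row x)| <= 2)%N -> x \in S -> y \in S ->
  ~~ is_top S x -> ~~ is_top S y -> box_row x = box_row y -> x = y.
Proof.
move=> S2 xS yS xT yT xy; have [t tT tx] := is_top_exists xS.
apply/eqP; apply: contraTT S2 => nxy; rewrite -ltnNge.
have nxt : x != t by apply: contraNneq xT => ->.
have nyt : y != t by apply: contraNneq yT => ->.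
apply: (@leq_trans #|t |: [set x; y]|).
  by rewrite cardsU1 cards2 nxy !inE negb_or eq_sym nxt eq_sym nyt.
apply/subset_leq_card/subsetP => z; rewrite !inE => /orP[|/orP[]] /eqP->.
- by rewrite is_top_mem ?tx /=.
- by rewrite xS /=.
- by rewrite yS xy /=.
Qed.

Lemma in_row_top_vec u k : in_row (jumps u) k != set0 ->
  exists2 x, is_top (jumps u) x & box_row x = k.
Proof.
case/set0Pn=> x; rewrite inE => /andP[/is_top_exists[t tT tx] /eqP <-].
by exists t.
Qed.

(* Otherwise all the rows of [U] would be proportional. *)
Lemma two_colors (U : 'M[K]_(n, 2)) (u := box_rows U) (a := top_vec u (jumps u))
    (c : 'I_3 -> bool) :
    \dim (col_span U) = 2%N ->
    (forall k l, a k != 0 -> a l != 0 -> (det2 (a k) (a l) == 0) = (c k == c l)) ->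
  exists x y, [/\ x \in jumps u, y \in jumps u &
    (is_top (jumps u) x == c (box_row x)) != (is_top (jumps u) y == c (box_row y))].
Proof.
move=> /dim2_det2[i [j]]; have [x ->] := box_indexP i; have [y ->] := box_indexP j.
rewrite -!/(box_rows _ _) -/u => xy cP.
have [/existsP[k k2]|/existsPn k1] := boolP [exists k, #|in_row (jumps u) k| == 2].
  (* A row with two jumps already shows both colors, one on its top box and the other on the
     remaining box. *)
  case/cards2P: k2 => z [w [nzw rE]].
  have zk : z \in in_row (jumps u) k by rewrite rE !inE eqxx.
  have wk : w \in in_row (jumps u) k by rewrite rE !inE eqxx orbT.
  move: zk wk; rewrite !mem_in_row => /andP[zS /eqP zk] /andP[wS /eqP wk].
  have zw : box_row z = box_row w by rewrite zk wk.
  exists z, w; split=> //; rewrite zk wk; suff -> : is_top (jumps u) z = ~~ is_top (jumps u) w.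
    by case: (is_top _ w); case: (c k).
  have [wT|wT] := boolP (is_top (jumps u) w).
    by apply/negP => zT; case/eqP: nzw; apply: is_top_uniq zT wT _.
  apply: contraNT nzw => zT; apply/eqP.
  by apply: nontop_uniq (card_in_row_jumps_le2 u _) zS wS zT wT zw.
(* Otherwise each row spans at most the line of its top vector, so two independent rows of [U] lie
   on distinct points, whose colors differ. *)
have lineP z : u z != 0 -> a (box_row z) != 0 /\ u z \in <[a (box_row z)]>%VS.
  move=> z0; have zW := mem_row_span u z.
  have d1 : \dim (row_span u (box_row z) (box_col z)) = 1%N.
    apply/eqP; rewrite eqn_leq lt0n dimv_eq0 andbC; apply/andP; split.
      by apply: contraNneq z0 => W0; rewrite -memv0 -W0.
    have := k1 (box_row z); have := card_in_row_jumps_le2 u (box_row z).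
    rewrite leq_eqVlt => /orP[->//|+ _]; rewrite ltnS; apply: leq_trans.
    rewrite card_in_row_jumps dimvS //; apply/subv_sumP => w /andP[wz _].
    by apply: sumv_sup (subvv _); rewrite wz.
  have WE := row_span_dim1 d1; rewrite -/a in WE; rewrite -WE; split=> //.
  by apply/eqP => a0; move: d1; rewrite WE a0 dim_vline eqxx.
have [ux uy] := det2_neq0 xy; have [ax /vlineP[s xE]] := lineP _ ux.
have [ay /vlineP[t yE]] := lineP _ uy.
have cxy : c (box_row x) != c (box_row y).
  rewrite -cP //; apply: contraNneq xy => axy.
  by rewrite xE yE det2Zl det2Zr axy !mulr0.
have rowT (z : box) : a (box_row z) != 0 -> exists2 w, is_top (jumps u) w & box_row w = box_row z.
  by move=> az; apply: in_row_top_vec; rewrite -top_vec_jumps_eq0.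
have [x' x'T x'x] := rowT x ax; have [y' y'T y'y] := rowT y ay.
exists x', y'; rewrite !is_top_mem // x'T y'T x'x y'y; split=> //.
Qed.

(** Three distinct points make every row nonempty and give a black diagram; otherwise the coloring
    of the points splits the jumps into two gray sets. *)
Lemma diagram_exists (U : 'M[K]_(n, 2)) (u := box_rows U) : \dim (col_span U) = 2%N ->
  exists eta, diag_support eta = jumps u /\
    forall x y, is_top (jumps u) x -> is_top (jumps u) y ->
      collinear eta x y = (det2 (u x) (u y) == 0).
Proof.
move=> dU; pose a := top_vec u (jumps u).
have aE x : is_top (jumps u) x -> a (box_row x) = u x by apply: top_vecE.
have [black|[c cP]] := pattern_coloring a.
  have bS : black_set (jumps u).
    apply/forallP => k; rewrite card_in_row_jumps_le2 andbT card_gt0 -top_vec_jumps_eq0.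
    have [l kl] : exists l, k != l.
      by have [->|] := eqVneq k 0; [exists 1|exists 0].
    by have [] := det2_neq0 (black k l kl).
  exists (Black bS); split=> // x y xT yT /=.
  have [xy|xy] := eqVneq (box_row x) (box_row y).
    by rewrite (is_top_uniq xT yT xy) det2aa eqxx.
  by apply/esym/negbTE; rewrite -!aE // black.
have [x1 [x2 [x1J x2J x12]]] := two_colors dU cP.
(* A top box receives the color of its row and the other jump of the row the opposite color; hence
   each color occurs at most once per row. *)
pose col x := is_top (jumps u) x == c (box_row x).
pose A b := [set x in jumps u | col x == b].
have memA b x : (x \in A b) = (x \in jumps u) && (col x == b) by rewrite in_set.
have colI x y : x \in jumps u -> y \in jumps u -> box_row x = box_row y ->
    col x = col y -> x = y.
  move=> xJ yJ xy; rewrite /col xy => cxy.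
  have : is_top (jumps u) x = is_top (jumps u) y.
    by move: cxy; case: (c _); case: (is_top _ x); case: (is_top _ y).
  case: (boolP (is_top (jumps u) x)) => xT /esym yT; first exact: is_top_uniq xT yT xy.
  by apply: nontop_uniq (card_in_row_jumps_le2 u _) xJ yJ xT (negbT yT) xy.
have row1 b k : (#|in_row (A b) k| <= 1)%N.
  apply/card_le1_eqP => x y; rewrite !mem_in_row !memA => /andP[/andP[xJ /eqP xb] /eqP xk].
  by move=> /andP[/andP[yJ /eqP yb] /eqP yk]; apply: colI; rewrite ?xk ?xb.
have An0 b : A b != set0.
  apply/set0Pn; have [x1b|x1b] := eqVneq (col x1) b.
    by exists x1; rewrite memA x1J x1b /=.
  exists x2; rewrite memA x2J /=; move: x12 x1b; rewrite -!/(col _).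
  by case: (col x1); case: (col x2); case: b.
have dis : [disjoint A true & A false].
  rewrite -setI_eq0; apply/eqP/setP => x; rewrite in_setI in_set0 !memA.
  by case: (col x); rewrite ?andbF /= ?andbF.
have [A12 gP] := gray_pair_intro (An0 true) (An0 false) dis (row1 true) (row1 false).
have AE : A true :|: A false = jumps u.
  by apply/setP => x; rewrite in_setU !memA -andb_orr; case: (col x); rewrite andbT.
exists (Gray gP); split=> [|x y xT yT] /=; first by rewrite cover_pair.
have xJ := is_top_mem xT; have yJ := is_top_mem yT.
rewrite same_block_pair ?AE // !memA xJ yJ /= /col xT yT /=.
have an0 z : is_top (jumps u) z -> a (box_row z) != 0 by move=> zT; rewrite aE // (row_span_top zT).1.
rewrite -!aE // cP ?an0 //.
by case: (c _); case: (c _).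
Qed.

Lemma M_Gr2 eta : \dim (M_ K eta) = 2%N.
Proof. by have [U [-> _ -> _]] := diagram_basis eta. Qed.

(** A diagram with the jumps and coincidences of [U] is chosen; a change of basis [h] of its plane
    aligns the lines, after which the row filtrations agree and [borel_row_span] provides [g]. *)
Lemma Gr2_borel_diagram (V : {vspace 'cV[K]_n}) : \dim V = 2%N ->
  exists eta g, B_L K p q r g /\ V = act_Gr K p q r g (M_ K eta).
Proof.
move=> dV; have [v1 [v2 VE]] := dim2_col_pair dV; move: (col_pair v1 v2) VE dV => U -> dU.
have [eta [SE colE]] := diagram_exists dU.
have [U' [ME J' dU' colE']] := diagram_basis eta; rewrite SE in J' colE'.
set u := box_rows U in SE colE J' colE'; set u' := box_rows U' in J' colE'.
have rowT k : top_vec u (jumps u) k != 0 -> exists2 x, is_top (jumps u) x & box_row x = k.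
  by move=> uk; apply: in_row_top_vec; rewrite -top_vec_jumps_eq0.
have t0 k : (top_vec u' (jumps u) k == 0) = (top_vec u (jumps u) k == 0).
  by rewrite -{1}J' !top_vec_jumps_eq0 J'.
(* Empty rows give zero vectors on both sides; the remaining top vectors belong to top boxes, where
   both determinants are read by [collinear]. *)
have [k l|h hu hE] := three_lines_transport t0.
  have [uk|uk] := eqVneq (top_vec u (jumps u) k) 0.
    by move: (t0 k); rewrite uk eqxx => /eqP->; rewrite ![det2 0 _]det2C !det20 oppr0 eqxx.
  have [ul|ul] := eqVneq (top_vec u (jumps u) l) 0.
    by move: (t0 l); rewrite ul eqxx => /eqP->; rewrite !det20 eqxx.
  have [x xT <-] := rowT k uk; have [y yT <-] := rowT l ul.
  by rewrite !top_vecE // colE' // colE.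
have [|g gB UE] := (borel_row_span U (U' *m h)).2.
  apply/row_span_eqP; have -> : box_rows (U' *m h) = fun x => u' x *m h.
    by apply/funext => x; rewrite /box_rows row_mul.
  by rewrite jumps_mulmx // J'; split=> // k; rewrite top_vec_mulmx hE.
exists eta, g; split=> //; rewrite ME /act_Gr mx_act_col_span UE.
by rewrite mulmxA col_span_mulmx.
Qed.

(** Jumps and coincidences are unchanged by [g], which preserves the row filtrations, and by the
    change of basis [h], which multiplies [det2] by a nonzero scalar. *)
Lemma borel_diagram_inj eta eta' g : B_L K p q r g ->
  act_Gr K p q r g (M_ K eta) = M_ K eta' -> eta = eta'.
Proof.
have [U [-> J dU colE]] := diagram_basis eta; have [U' [-> J' dU' colE']] := diagram_basis eta'.
move=> gB; rewrite /act_Gr mx_act_col_span => /esym UU'.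
have [h hu U'E] := col_span_eq dU' UU'.
have WE := (borel_row_span (block_diag g *m (U *m h)) (U *m h)).1 (ex_intro2 _ _ g gB erefl).
rewrite mulmxA -U'E in WE; move/row_span_eqP: WE.
have -> : box_rows (U *m h) = fun x => box_rows U x *m h.
  by apply/funext => x; rewrite /box_rows row_mul.
rewrite jumps_mulmx // J J' => -[SE tE]; apply: collinear_inj => // x y xT yT.
rewrite -colE // -[RHS]colE' -?SE ?SE //.
have lineE z : is_top (diag_support eta) z -> <[box_rows U' z]>%VS = <[box_rows U z *m h]>%VS.
  by move=> zT; rewrite -!(top_vecE _ zT) -top_vec_mulmx -tE SE.
rewrite (vline_det2_eq0 (lineE x xT) (lineE y yT)) det2_mulmx mulf_eq0.
by move: hu; rewrite unitmxE unitfE => /negPf->; rewrite orbF.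
Qed.

End BorelBijection.

(* Imported only here because its set notations shadow those of finset. *)
From mathcomp Require Import classical_sets functions.

(** * Transitivity on complete flags and the stabilizer of the standard flag *)

Section Flags.
Variables (K : closedFieldType) (m : nat).
Implicit Types (g h : 'M[K]_m) (V : {vspace 'cV[K]_m}) (w : 'I_m -> 'cV[K]_m).

Lemma mx_actM g h V : mx_act (g *m h) V = mx_act g (mx_act h V).
Proof.
rewrite /mx_act -limg_comp; apply: eq_in_limg => v _.
by rewrite comp_lfunE !lfunE /= mulmxA.
Qed.

Lemma mx_act1 V : mx_act 1%:M V = V.
Proof.
apply/vspaceP => v; apply/memv_imgP/idP => [[u uV ->]|vV]; first by rewrite lfunE /= mul1mx.
by exists v; rewrite // lfunE /= mul1mx.
Qed.

Lemma mx_actK g V : g \in unitmx -> mx_act (invmx g) (mx_act g V) = V.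
Proof. by move=> gu; rewrite -mx_actM mulVmx // mx_act1. Qed.

Lemma dim_mx_act g V : g \in unitmx -> \dim (mx_act g V) = \dim V.
Proof.
have le h W : (\dim (mx_act h W) <= \dim W)%N.
  by rewrite -(limg_ker_dim (linfun (mulmx h)) W) leq_addl.
by move=> gu; apply/eqP; rewrite eqn_leq le -{1}(mx_actK V gu) le.
Qed.

Lemma mx_act_full_unit g : mx_act g fullv = fullv -> g \in unitmx.
Proof.
move=> gf; have /fin_all_exists[w wE] (j : 'I_m) : exists w : 'cV[K]_m,
    g *m w = delta_mx j 0.
  have : delta_mx j 0 \in mx_act g fullv by rewrite gf memvf.
  by case/memv_imgP=> w _; rewrite lfunE /= => ->; exists w.
suff /mulmx1_unit[] : g *m \matrix_(i, j) w j i 0 = 1%:M by [].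
apply/matrixP => i j; have /colP/(_ i) := wE j; rewrite !mxE eqxx andbT => <-.
by apply: eq_bigr => k _; rewrite !mxE.
Qed.

(** For the standard basis this is [std_flag], indexed by natural numbers to allow induction. *)
Definition head_span w (i : nat) : {vspace 'cV[K]_m} := (\sum_(j < m | (j < i)%N) <[w j]>)%VS.

Lemma head_spanS w (j : 'I_m) : head_span w j.+1 = (head_span w j + <[w j]>)%VS.
Proof.
rewrite /head_span (bigD1 j) //= addvC; congr (_ + _)%VS; apply: eq_bigl => k.
by rewrite ltnS andbC [RHS]ltn_neqAle.
Qed.

Lemma dim_head_span w : (forall j, w j \notin head_span w j) ->
  forall i, (i <= m)%N -> \dim (head_span w i) = i.
Proof.
move=> wN; elim=> [|i IH] im; first by rewrite /head_span big_pred0_eq dimv0.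
by rewrite (head_spanS w (Ordinal im)) dim_add_line ?IH ?(ltnW im) //; apply: wN.
Qed.

Lemma mem_std_flag (i : nat) (v : 'cV[K]_m) :
  reflect (forall j : 'I_m, (i <= j)%N -> v j 0 = 0) (v \in head_span (delta_mx^~ 0) i).
Proof.
apply: (iffP memv_sumP) => [[vs vsP ->] j ij|v0].
  rewrite summxE big1 // => k ki; have /vlineP[c ->] := vsP k ki.
  rewrite !mxE; have [jk|] := eqVneq j k; last by rewrite mulr0.
  by move: ki; rewrite -jk ltnNge ij.
exists (fun j => v j 0 *: delta_mx j 0) => [j _|]; first by rewrite memvZ ?memv_line.
apply/colP => j; rewrite summxE; have [ij|ji] := leqP i j.
  rewrite v0 // big1 // => k ki; rewrite !mxE; have [jk|] := eqVneq j k; last by rewrite mulr0.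
  by move: ki; rewrite -jk ltnNge ij.
rewrite (bigD1 j) //= !mxE !eqxx mulr1 big1 ?addr0 // => k /andP[_ kj].
by rewrite !mxE eq_sym (negPf kj) mulr0.
Qed.

Lemma complete_std_flag : complete_flags K m (std_flag K m).
Proof.
split=> [i|i j ij].
  apply: (@dim_head_span (delta_mx^~ 0)); last by rewrite -ltnS.
  move=> j; apply/mem_std_flag => /(_ j (leqnn j)); rewrite mxE !eqxx => /eqP.
  by rewrite oner_eq0.
apply/subv_sumP => k ki; apply: sumv_sup (subvv _); exact: leq_trans ij.
Qed.

(** Members of the two flags have equal dimensions, so one inclusion suffices. *)
Lemma flag_act_std_flag g (F : flag K m) : g \in unitmx -> complete_flags K m F ->
  (forall (i : 'I_m.+1) (j : 'I_m), (j < i)%N -> g *m delta_mx j 0 \in F i) ->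
  flag_act g (std_flag K m) = F.
Proof.
move=> gu [dF _] gF; apply/funext => i; apply/eqP; rewrite eqEdim dF dim_mx_act //.
rewrite (complete_std_flag.1 i) leqnn andbT /flag_act /mx_act /std_flag limg_sum; apply/subv_sumP => j ji.
by rewrite limg_line lfunE -memvE gF.
Qed.

Lemma std_flag_stabP g : g \in unitmx ->
  flag_act g (std_flag K m) = std_flag K m <-> is_trig_mx g^T.
Proof.
move=> gu; split=> [gF|/is_trig_mxP gt].
  apply/is_trig_mxP => j i ji; rewrite mxE.
  (* The index [lift ord0 j] is [j + 1], that of the first member containing the basis vector [j];
     membership of column [j] of [g] kills its entries below the diagonal. *)
  have : g *m delta_mx j 0 \in std_flag K m (lift ord0 j).
    rewrite -[in X in _ \in X]gF /flag_act; apply/memv_imgP; exists (delta_mx j 0).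
      by apply/mem_std_flag => k jk; rewrite mxE; case: eqP => // kj; rewrite kj ltnn in jk.
    by rewrite lfunE.
  by move/mem_std_flag/(_ i ji); rewrite -colE mxE.
apply: flag_act_std_flag => // [|i j ji]; first exact: complete_std_flag.
apply/mem_std_flag => k ik; rewrite -colE mxE.
by have := gt j k (leq_trans ji ik); rewrite mxE.
Qed.

Lemma complete_flag_std (F : flag K m) : complete_flags K m F ->
  exists2 g, g \in unitmx & F = flag_act g (std_flag K m).
Proof.
(* An adapted basis: [w j] lies in the member of index [j + 1] but not in that of index [j]. These
   vectors are the columns of [g]. *)
move=> [dF nF]; have /fin_all_exists2[w wS wN] (j : 'I_m) :
    exists2 w, w \in F (lift ord0 j) & w \notin F (widen_ord (leqnSn m) j).
  by apply/subvPn/negP => /dimvS; rewrite !dF /= ltnn.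
have wE i (im : (i < m.+1)%N) : head_span w i = F (Ordinal im).
  elim: i im => [|i IH] im.
    rewrite /head_span big_pred0_eq; apply/esym/eqP; rewrite -dimv_eq0 dF //.
  have im' : (i < m)%N by [].
  rewrite (head_spanS w (Ordinal im')) (IH (ltnW im)).
  have FS : F (Ordinal im) = F (lift ord0 (Ordinal im')) by congr F; apply: val_inj.
  have FW : F (Ordinal (ltnW im)) = F (widen_ord (leqnSn m) (Ordinal im')).
    by congr F; apply: val_inj.
  apply/eqP; rewrite eqEdim subv_add nF //= FS -memvE wS FW dF.
  by rewrite dim_add_line ?wN // dF leqnn.
pose g : 'M[K]_m := \matrix_(i, j) w j i 0.
have gE j : g *m delta_mx j 0 = w j by rewrite -colE; apply/colP => i; rewrite !mxE.
have gF : flag_act g (std_flag K m) = F.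
  apply/funext => i; case: i => i im; rewrite -wE /flag_act /mx_act /std_flag limg_sum.
  by apply: eq_bigr => j _; rewrite limg_line lfunE /= gE.
exists g => //; apply: mx_act_full_unit; apply/eqP; rewrite eqEdim subvf /=.
rewrite dimvf /dim /= muln1; apply: (@leq_trans (\dim (F ord_max))); first by rewrite dF.
by rewrite -{1}gF; apply/dimvS/limgS/subvf.
Qed.

End Flags.

(** * Generalities on orbits *)

Section Orbits.
Variables (G T : Type) (H : set G) (act : G -> T -> T).

(** Cancellation is assumed on [H] only, since the type of triples also contains singular
    matrices. *)
Lemma orbit_of_act (mul : G -> G -> G) (inv : G -> G) g x :
    (forall g h, H g -> H h -> H (mul g h)) -> (forall g, H g -> H (inv g)) ->
    (forall g h x, act (mul g h) x = act g (act h x)) ->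
    (forall g x, H g -> act (inv g) (act g x) = x) ->
  H g -> orbit_of H act (act g x) = orbit_of H act x.
Proof.
move=> HM HV actM actK gH; apply/seteqP; split=> _ [h hH <-].
  by exists (mul h g); [apply: HM|rewrite actM].
by exists (mul h (inv g)); [apply/HM/HV|rewrite actM actK].
Qed.

Lemma orbit_of_eq (one : G) x y : H one -> (forall x, act one x = x) ->
  orbit_of H act x = orbit_of H act y -> exists2 g, H g & act g x = y.
Proof.
move=> H1 act1 xy; have : orbit_of H act y y by exists one.
by rewrite -xy => -[g gH gE]; exists g.
Qed.

End Orbits.

(** * Group laws of [L_group] and [B_L] and their actions *)

Section Triples.
Variables (K : closedFieldType) (p q r : nat).
Local Notation n := (p + q + r)%N.
Local Notation triple := (triple K p q r).
Implicit Types (g h : triple).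

Definition triple_mul g h : triple := (g.1.1 *m h.1.1, g.1.2 *m h.1.2, g.2 *m h.2).
Definition triple_inv g : triple := (invmx g.1.1, invmx g.1.2, invmx g.2).
Definition triple_one : triple := (1%:M, 1%:M, 1%:M).

Lemma block_diagM g h : block_diag (triple_mul g h) = block_diag g *m block_diag h.
Proof.
case: g h => [[a b] c] [[a' b'] c']; rewrite /block_diag /= !mulmx_block.
by rewrite !(mul0mx, mulmx0, addr0, add0r).
Qed.

Lemma block_diag1 : block_diag triple_one = 1%:M.
Proof. by rewrite /block_diag /= -!scalar_mx_block. Qed.

Lemma triple_mulV g : L_group K p q r g -> triple_mul (triple_inv g) g = triple_one.
Proof. by case=> au bu cu; rewrite /triple_mul /= !mulVmx. Qed.

Lemma L_group1 : L_group K p q r triple_one.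
Proof. by split; apply: unitmx1. Qed.

Lemma L_groupM g h : L_group K p q r g -> L_group K p q r h -> L_group K p q r (triple_mul g h).
Proof. by case=> ga gb gc [ha hb hc]; split; rewrite unitmx_mul ?ga ?gb ?gc. Qed.

Lemma L_groupV g : L_group K p q r g -> L_group K p q r (triple_inv g).
Proof. by case=> ga gb gc; split; rewrite unitmx_inv. Qed.

Lemma block_diag_unit g : L_group K p q r g -> block_diag g \in unitmx.
Proof.
by move=> gL; have /mulmx1_unit[] : block_diag (triple_inv g) *m block_diag g = 1%:M;
  rewrite -?block_diagM ?triple_mulV ?block_diag1.
Qed.

(** This links the two orbit problems, and it yields closure of [B_L] under products and inverses
    without computing with triangular matrices. *)
Lemma B_L_stab g : B_L K p q r g <-> [/\ L_group K p q r g,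
  flag_act g.1.1 (std_flag K p) = std_flag K p, flag_act g.1.2 (std_flag K q) = std_flag K q
  & flag_act g.2 (std_flag K r) = std_flag K r].
Proof.
split=> [[gL [ga gb gc]]|[gL ga gb gc]]; have [au bu cu] := gL.
  by split=> //; apply/std_flag_stabP.
by split=> //; split; apply/std_flag_stabP.
Qed.

Lemma flag_actM m (a b : 'M[K]_m) F : flag_act (a *m b) F = flag_act a (flag_act b F).
Proof. by apply/funext => i; apply: mx_actM. Qed.

Lemma flag_act1 m (F : flag K m) : flag_act 1%:M F = F.
Proof. by apply/funext => i; apply: mx_act1. Qed.

Lemma flag_actK m (a : 'M[K]_m) F : a \in unitmx -> flag_act (invmx a) (flag_act a F) = F.
Proof. by move=> au; apply/funext => i; apply: mx_actK. Qed.

Lemma act_GrM g h V : act_Gr K p q r (triple_mul g h) V = act_Gr K p q r g (act_Gr K p q r h V).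
Proof. by rewrite /act_Gr block_diagM mx_actM. Qed.

Lemma act_Gr1 V : act_Gr K p q r triple_one V = V.
Proof. by rewrite /act_Gr block_diag1 mx_act1. Qed.

Lemma act_GrK g V : L_group K p q r g ->
  act_Gr K p q r (triple_inv g) (act_Gr K p q r g V) = V.
Proof. by move=> gL; rewrite -act_GrM triple_mulV // act_Gr1. Qed.

Lemma B_L1 : B_L K p q r triple_one.
Proof. by apply/B_L_stab; split; rewrite ?flag_act1 //; apply: L_group1. Qed.

Lemma B_LM g h : B_L K p q r g -> B_L K p q r h -> B_L K p q r (triple_mul g h).
Proof.
move=> /B_L_stab[gL ga gb gc] /B_L_stab[hL ha hb hc]; apply/B_L_stab.
by split; rewrite ?flag_actM ?ha ?hb ?hc //; apply: L_groupM.
Qed.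

Lemma B_LV g : B_L K p q r g -> B_L K p q r (triple_inv g).
Proof.
move=> /B_L_stab[gL ga gb gc]; have [au bu cu] := gL; apply/B_L_stab.
split; first exact: L_groupV.
- by rewrite -{1}ga flag_actK.
- by rewrite -{1}gb flag_actK.
- by rewrite -{1}gc flag_actK.
Qed.

Lemma act_flags_Gr1 x : act_flags_Gr K p q r triple_one x = x.
Proof. by case: x => [[[F1 F2] F3] V]; rewrite /= !flag_act1 act_Gr1. Qed.

Lemma act_flags_GrM g h x : act_flags_Gr K p q r (triple_mul g h) x =
  act_flags_Gr K p q r g (act_flags_Gr K p q r h x).
Proof.
case: g h x => [[a b] c] [[a' b'] c'] [[[F1 F2] F3] V].
by rewrite /= !flag_actM -act_GrM.
Qed.

Lemma act_flags_GrK g x : L_group K p q r g ->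
  act_flags_Gr K p q r (triple_inv g) (act_flags_Gr K p q r g x) = x.
Proof. by move=> gL; rewrite -act_flags_GrM triple_mulV // act_flags_Gr1. Qed.

Lemma borel_orbit_act g V : B_L K p q r g ->
  orbit_of (B_L K p q r) (act_Gr K p q r) (act_Gr K p q r g V) =
  orbit_of (B_L K p q r) (act_Gr K p q r) V.
Proof.
apply: orbit_of_act B_LM B_LV act_GrM _ => h W [hL _].
exact: act_GrK.
Qed.

Lemma flags_orbit_act g x : L_group K p q r g ->
  orbit_of (L_group K p q r) (act_flags_Gr K p q r) (act_flags_Gr K p q r g x) =
  orbit_of (L_group K p q r) (act_flags_Gr K p q r) x.
Proof.
exact: orbit_of_act L_groupM L_groupV act_flags_GrM act_flags_GrK.
Qed.

End Triples.

(** * The two bijections with colored diagrams *)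

Theorem theorem5p4 (K : closedFieldType) (charK0 : [pchar K]%R =i pred0)
    (p q r : nat) (n_ge2 : (2 <= p + q + r)%N) :
  set_bij [set: colored_diagram p q r]%classic
    (orbits (L_group K p q r) (act_flags_Gr K p q r) (flags_Gr_variety K p q r))
    (fun eta => orbit_of (L_group K p q r) (act_flags_Gr K p q r)
                         (flags_M_ K eta)) /\
  set_bij [set: colored_diagram p q r]%classic
    (orbits (B_L K p q r) (act_Gr K p q r) (Gr2 K (p + q + r)))
    (fun eta => orbit_of (B_L K p q r) (act_Gr K p q r) (M_ K eta)).
Proof.
have MGr eta : Gr2 K (p + q + r) (@M_ K p q r eta) by apply: M_Gr2.
split; split.
- move=> eta _; exists (flags_M_ K eta) => //.
  by split; [split; [split|]|exact: MGr]; apply: complete_std_flag.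
(* An element carrying one representative to the other fixes the three standard flags, hence lies in
   [B_L]. *)
- move=> eta eta' _ _ /(orbit_of_eq (@L_group1 K p q r) (@act_flags_Gr1 K p q r))[[[a b] c] gL].
  case=> ga gb gc gM; apply: (borel_diagram_inj charK0 _ gM).
  by apply/B_L_stab.
- move=> _ [[[[F1 F2] F3] V] [[[/= F1c F2c] F3c] dV] <-].
  have [a au F1E] := complete_flag_std F1c; have [b bu F2E] := complete_flag_std F2c.
  have [c cu F3E] := complete_flag_std F3c; pose g : triple K p q r := (a, b, c).
  have gL : L_group K p q r g by [].
  (* The inverse of [g] makes the three flags standard; the plane is then moved to some [M_ K eta]
     by [B_L], which keeps them standard. *)
  have dV' : \dim (act_Gr K p q r (triple_inv g) V) = 2%N.
    by rewrite dim_mx_act // block_diag_unit //; apply: L_groupV.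
  have [eta [h [hB VE]]] := Gr2_borel_diagram charK0 dV'.
  exists eta => //; have /B_L_stab[hL ha hb hc] := hB.
  rewrite -[RHS](flags_orbit_act _ (L_groupV gL)) -(flags_orbit_act _ hL); congr orbit_of.
  move: h hB hL ha hb hc VE => [[a' b'] c'] /= hB hL ha hb hc VE.
  by rewrite ha hb hc F1E F2E F3E !flag_actK // -VE.
- by move=> eta _; exists (M_ K eta).
- move=> eta eta' _ _ /(orbit_of_eq (@B_L1 K p q r) (@act_Gr1 K p q r))[g gB].
  exact: borel_diagram_inj.
- move=> _ [V dV <-]; have [eta [g [gB ->]]] := Gr2_borel_diagram charK0 dV.
  by exists eta => //; rewrite borel_orbit_act.
Qed.
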